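(* (a) For any $w\in\mathbf{I}_*$ there is a unique element $$A_w=v^{-l(w)}\sum_{y\in\mathbf{I}_*;\,y\le w}P^\sigma_{y,w}a_y\in\underline{M}$$ (with $P^\sigma_{y,w}\in\mathbf{Z}[u]$) such that $\overline{A_w}=A_w$, $P^\sigma_{w,w}=1$, and for any $y\in\mathbf{I}_*$ with $y<w$ we have $\deg P^\sigma_{y,w}\le (l(w)-l(y)-1)/2$ (degree in $u$). (b) The elements $A_w$ ($w\in\mathbf{I}_*$) form an $\underline{\mathcal{A}}$-basis of $\underline{M}$.
   Context: $W$ is a Coxeter group with set of simple reflections $S$, length function $l:W\to\mathbf{N}$ and Bruhat order $\le$. $w\mapsto w^*$ is an automorphism of $W$ with square $1$ which leaves $S$ stable. $\mathbf{I}_*=\{w\in W : (w^* )^{-1}=w\}$. $u$ is an indeterminate and $\mathcal{A}=\mathbf{Z}[u,u^{-1}]$. $\mathfrak{H}$ is the free $\mathcal{A}$-module with basis $(T_w)_{w\in W}$ with the unique $\mathcal{A}$-algebra structure with unit $T_1$ such that $T_wT_{w'}=T_{ww'}$ if $l(ww')=l(w)+l(w')$, and $(T_s+1)(T_s-u^2)=0$ for all $s\in S$. $\overline{\phantom{x}}:\mathfrak{H}\to\mathfrak{H}$ is the unique ring involution such that $\overline{u^nT_x}=u^{-n}T_{x^{-1}}^{-1}$ for $x\in W$, $n\in\mathbf{Z}$. $M$ is the free $\mathcal{A}$-module with basis $\{a_w : w\in\mathbf{I}_*\}$, with its unique $\mathfrak{H}$-module structure such that for $s\in S$, $w\in\mathbf{I}_*$: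 $T_s a_w = u a_w + (u+1)a_{sw}$ if $sw = ws^* > w$; $T_s a_w = (u^2-u-1)a_w + (u^2-u)a_{sw}$ if $sw = ws^* < w$; $T_s a_w = a_{sws^*}$ if $sw\ne ws^*$, $sw > w$; $T_s a_w = (u^2-1)a_w + u^2 a_{sws^*}$ if $sw\ne ws^*$, $sw < w$. $\overline{\phantom{x}}:M\to M$ is the unique $\mathbf{Z}$-linear map such that $\overline{hm}=\overline{h}\,\overline{m}$ for $h\in\mathfrak{H}$, $m\in M$ and $\overline{a_1}=a_1$. $v$ is an indeterminate, $\underline{\mathcal{A}}=\mathbf{Z}[v,v^{-1}]$, which contains $\mathcal{A}$ as a subring via $u=v^2$. $\underline{M}=\underline{\mathcal{A}}\otimes_{\mathcal{A}}M\supset M$, and $\overline{\phantom{x}}$ is extended to a $\mathbf{Z}$-linear map $\underline{M}\to\underline{M}$ by $\overline{v^nm}=v^{-n}\overline{m}$ for $m\in M$, $n\in\mathbf{Z}$. *)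

(* Defs.v *)
From HB Require Import structures.
From Stdlib Require Import Relation_Operators.
From mathcomp Require Import all_boot all_order all_algebra finmap.
From mathcomp Require Import boolp classical_sets fsbigop.

Set Implicit Arguments.
Unset Strict Implicit.
Unset Printing Implicit Defensive.

Import GRing.Theory.
Local Open Scope ring_scope.

Section Zeval.
Variables (R : comNzRingType) (t : R).

Definition zeval (p : {poly int}) : R := (map_poly intr p).[t].

Lemma zevalC c : zeval c%:P = c%:~R.
Proof. by rewrite /zeval map_polyC hornerC. Qed.
Lemma zevalX : zeval 'X = t.
Proof. by rewrite /zeval map_polyX hornerX. Qed.
Lemma zevalB p q : zeval (p - q) = zeval p - zeval q.
Proof. by rewrite /zeval rmorphB hornerD hornerN. Qed.
Lemma zevalM p q : zeval (p * q) = zeval p * zeval q.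
Proof. by rewrite /zeval rmorphM hornerM. Qed.
Lemma zevalXn n : zeval 'X^n = t ^+ n.
Proof. by rewrite /zeval map_polyXn hornerXn. Qed.
End Zeval.

Section LaurentPred.
Variables (F : fieldType) (t : F).

Definition laurent_pred : {pred F} :=
  fun x => `[< exists (p : {poly int}) (n : nat), x = zeval t p / t ^+ n >].

Lemma laurent_predP (x : F) :
  reflect (exists (p : {poly int}) (n : nat), x = zeval t p / t ^+ n)
          (x \in laurent_pred).
Proof. exact: asboolP. Qed.

Lemma laurent_predZ (c : int) : c%:~R \in laurent_pred.
Proof. by apply/laurent_predP; exists c%:P, 0%N; rewrite zevalC expr0 divr1. Qed.

Lemma laurent_pred0 x : t = 0 -> x \in laurent_pred ->
  exists c : int, x = c%:~R.
Proof.
move=> t0 /laurent_predP; rewrite t0 => -[p [[|n] ->]]; last first.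
  by exists 0; rewrite expr0n invr0 mulr0.
exists p`_0; rewrite expr0 divr1 /zeval horner_coef0 coef_map_id0 //.
Qed.

Lemma laurent_subring_closed : subring_closed laurent_pred.
Proof.
have [t0|t0] := eqVneq t 0.
  split=> [|x y /(laurent_pred0 t0)[c ->] /(laurent_pred0 t0)[d ->]
           |x y /(laurent_pred0 t0)[c ->] /(laurent_pred0 t0)[d ->]].
  - exact: (laurent_predZ 1).
  - by rewrite -rmorphB; apply: laurent_predZ.
  - by rewrite -rmorphM; apply: laurent_predZ.
split=> [|x y /laurent_predP[p [n ->]] /laurent_predP[q [m ->]]
         |x y /laurent_predP[p [n ->]] /laurent_predP[q [m ->]]].
- exact: (laurent_predZ 1).
- apply/laurent_predP; exists (p * 'X^m - q * 'X^n), (n + m)%N.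
  by rewrite -mulNr addf_div ?expf_neq0 // zevalB !zevalM !zevalXn exprD mulNr.
- apply/laurent_predP; exists (p * q), (n + m)%N.
  by rewrite zevalM exprD mulf_div.
Qed.

HB.instance Definition _ :=
  GRing.isSubringClosed.Build F laurent_pred laurent_subring_closed.

Lemma laurent_gen : t \in laurent_pred.
Proof. by apply/laurent_predP; exists 'X, 0%N; rewrite zevalX expr0 divr1. Qed.

Record laurent :=
  Laurent { laurent_val :> F; _ : laurent_val \in laurent_pred }.

HB.instance Definition _ := [isSub for laurent_val].
HB.instance Definition _ := [Choice of laurent by <:].
HB.instance Definition _ := [SubChoice_isSubComNzRing of laurent by <:].

Implicit Types x y : laurent.

Definition laurent_unit : {pred laurent} :=
  fun x => (val x != 0) && ((val x)^-1 \in laurent_pred).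
Definition laurent_inv x : laurent :=
  if x \in laurent_unit then insubd x (val x)^-1 else x.

Lemma laurent_mulVx : {in laurent_unit, left_inverse 1 laurent_inv *%R}.
Proof.
move=> x xu; apply: val_inj; rewrite /laurent_inv xu rmorphM.
by case/andP: xu => x0 xV; rewrite /= insubdK // mulVf.
Qed.

Lemma laurent_unitPl x y : y * x = 1 -> x \in laurent_unit.
Proof.
move=> /(congr1 val); rewrite rmorphM rmorph1 /= => yx.
have x0 : val x != 0.
  by apply: contra_eq_neq yx => ->; rewrite mulr0 eq_sym oner_neq0.
apply/andP; split=> //; suff -> : (val x)^-1 = val y by exact: valP.
by apply: (mulIf x0); rewrite mulVf.
Qed.

Lemma laurent_inv_out : {in [predC laurent_unit], laurent_inv =1 id}.
Proof. by move=> x /negbTE xu; rewrite /laurent_inv xu. Qed.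

HB.instance Definition _ :=
  GRing.ComNzRing_hasMulInverse.Build laurent
    laurent_mulVx laurent_unitPl laurent_inv_out.

End LaurentPred.

Section LaurentSqr.
Variables (F : fieldType) (t : F).

Lemma laurent_sqr : {subset laurent_pred (t ^+ 2) <= laurent_pred t}.
Proof.
move=> x /laurent_predP[p [n ->]]; apply/laurent_predP.
exists (p \Po 'X^2), (2 * n)%N; rewrite -exprM /zeval.
by rewrite map_comp_poly map_polyXn horner_comp hornerXn.
Qed.

Definition laurent_incl (x : laurent (t ^+ 2)) : laurent t :=
  Laurent (laurent_sqr (valP x)).

Lemma laurent_incl_zmod : zmod_morphism laurent_incl.
Proof. by move=> x y; apply: val_inj. Qed.
Lemma laurent_incl_monoid : monoid_morphism laurent_incl.
Proof. by split=> [|x y]; apply: val_inj. Qed.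
HB.instance Definition _ :=
  GRing.isZmodMorphism.Build _ _ laurent_incl laurent_incl_zmod.
HB.instance Definition _ :=
  GRing.isMonoidMorphism.Build _ _ laurent_incl laurent_incl_monoid.
End LaurentSqr.

Definition vQ : {fraction {poly int}} := tofrac 'X.

(* Au = Z[u, 1/u] and Av = Z[v, 1/v], both inside Q(v), with u = v ^ 2. *)
Notation Av := (laurent vQ).
Notation Au := (laurent (vQ ^+ 2)).

Definition v : Av := Laurent (laurent_gen vQ).
Definition u : Au := Laurent (laurent_gen (vQ ^+ 2)).

Definition Au_Av : {rmorphism Au -> Av} := @laurent_incl _ vQ.

Lemma Au_Av_u : Au_Av u = v ^+ 2.
Proof. by apply: val_inj; rewrite rmorphXn. Qed.

Lemma v_unit : v \is a GRing.unit.
Proof.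
apply/andP; split; first by rewrite tofrac_eq0 polyX_eq0.
by apply/laurent_predP; exists 1, 1%N; rewrite /zeval rmorph1 hornerC expr1 div1r.
Qed.

Lemma u_unit : u \is a GRing.unit.
Proof.
apply/andP; split; first by rewrite expf_neq0 // tofrac_eq0 polyX_eq0.
by apply/laurent_predP; exists 1, 1%N; rewrite /zeval rmorph1 hornerC expr1 div1r.
Qed.

(* The family (b i), i in D, is a basis; values of b outside D are ignored. *)
Definition is_basis (R : nzRingType) (V : lmodType R) (I : choiceType)
    (D : set I) (b : I -> V) : Prop :=
  forall x : V, exists! c : {fsfun I -> R with 0},
    (forall i, i \in finsupp c -> D i) /\
    x = \sum_(i <- finsupp c) c i *: b i.

(* (M', j) is the tensor product R' (x)_R M, by its universal property. *)
Definition is_base_change (R R' : comNzRingType) (phi : {rmorphism R -> R'})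
    (M : lmodType R) (M' : lmodType R') (j : M -> M') : Prop :=
  let semilinear (N : lmodType R') (f : M -> N) :=
    forall (c : R) (x y : M), f (c *: x + y) = phi c *: f x + f y in
  semilinear M' j /\
  forall (N : lmodType R') (f : M -> N), semilinear N f ->
    (exists g : {linear M' -> N}, forall m, g (j m) = f m) /\
    (forall g h : {linear M' -> N},
      (forall m, g (j m) = h (j m)) -> forall x, g x = h x).

Section Coxeter.
Local Open Scope group_scope.
Variables (W : groupType) (S : set W).

Definition is_word (w : W) (e : seq W) : Prop :=
  (forall s, s \in e -> S s) /\ w = \prod_(s <- e) s.

(* The last field says that the relations (s t)^m(s,t) = 1, with m(s,t) the
   order of s t (no relation if it is infinite), present W. *)
Record coxeter_system : Prop := {
  cox_order2 : forall s, S s -> s <> 1 /\ s * s = 1;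
  cox_gen : forall w, exists e, is_word w e;
  cox_pres : forall (G : groupType) (f : W -> G),
    (forall s t n, S s -> S t -> (s * t) ^+ n = 1 -> (f s * f t) ^+ n = 1) ->
    exists phi : {multiplicative W -> G}, forall s, S s -> phi s = f s }.

Definition len (w : W) : nat :=
  xget 0%N [set n | (exists2 e, is_word w e & size e = n) /\
                    forall e, is_word w e -> (n <= size e)%N].

Definition reflection (t : W) : Prop :=
  exists s x, S s /\ t = x * s * x^-1.

Definition bruhat_le : W -> W -> Prop :=
  clos_refl_trans W (fun y w =>
    exists t, [/\ reflection t, w = y * t & (len y < len w)%N]).

Definition bruhat_lt (y w : W) : Prop := bruhat_le y w /\ y <> w.

Record star_automorphism (star : W -> W) : Prop := {
  star_mul : forall x y, star (x * y) = star x * star y;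
  star_star : forall x, star (star x) = x;
  star_S : forall s, S s -> S (star s) }.

Definition twisted_involution (star : W -> W) : set W :=
  [set w | (star w)^-1 = w].

End Coxeter.

Section Hecke.
Variables (W : groupType) (S : set W).

Record hecke_algebra (H : unitAlgType Au) (T : W -> H) : Prop := {
  hecke_basis : is_basis setT T;
  hecke_one : T 1%g = 1;
  hecke_mul : forall w w', len S (w * w')%g = (len S w + len S w')%N ->
    T w * T w' = T (w * w')%g;
  hecke_quad : forall s, S s -> (T s + 1) * (T s - (u ^+ 2)%:A) = 0 }.

Record hecke_bar (H : unitAlgType Au) (T : W -> H)
    (barH : {rmorphism H -> H}) : Prop := {
  hecke_bar_invol : forall h, barH (barH h) = h;
  hecke_bar_T : forall (n : int) (x : W),
    barH (u ^ n *: T x) = u ^ (- n) *: (T (x^-1)%g)^-1 }.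

Variable star : W -> W.
Local Notation I := (twisted_involution star).

(* M is free on a_w, w in I; if s in S and w in I then s w s^* is in I, and so
   is s w when s w = w s^*, hence a is only used on I. *)
Record involution_module (H : unitAlgType Au) (T : W -> H)
    (M : lmodType Au) (a : W -> M) (act : H -> M -> M) : Prop := {
  im_basis : is_basis I a;
  im_linl : forall m c h h', act (c *: h + h') m = c *: act h m + act h' m;
  im_linr : forall h c m m', act h (c *: m + m') = c *: act h m + act h m';
  im_act1 : forall m, act 1 m = m;
  im_actM : forall h h' m, act (h * h') m = act h (act h' m);
  im_comm_up : forall s w, S s -> I w ->
    (s * w = w * star s)%g -> bruhat_lt S w (s * w)%g ->
    act (T s) (a w) = u *: a w + (u + 1) *: a (s * w)%g;
  im_comm_down : forall s w, S s -> I w ->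
    (s * w = w * star s)%g -> bruhat_lt S (s * w)%g w ->
    act (T s) (a w) =
      (u ^+ 2 - u - 1) *: a w + (u ^+ 2 - u) *: a (s * w)%g;
  im_up : forall s w, S s -> I w ->
    (s * w <> w * star s)%g -> bruhat_lt S w (s * w)%g ->
    act (T s) (a w) = a (s * w * star s)%g;
  im_down : forall s w, S s -> I w ->
    (s * w <> w * star s)%g -> bruhat_lt S (s * w)%g w ->
    act (T s) (a w) =
      (u ^+ 2 - 1) *: a w + u ^+ 2 *: a (s * w * star s)%g }.

Record involution_bar (H : unitAlgType Au) (barH : H -> H)
    (M : lmodType Au) (a : W -> M) (act : H -> M -> M)
    (barM : {additive M -> M}) : Prop := {
  ib_semi : forall h m, barM (act h m) = act (barH h) (barM m);
  ib_one : barM (a 1%g) = a 1%g }.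

Definition extends_bar (M : lmodType Au) (barM : M -> M)
    (M' : lmodType Av) (j : M -> M') (barM' : {additive M' -> M'}) : Prop :=
  forall (n : int) (m : M), barM' (v ^ n *: j m) = v ^ (- n) *: j (barM m).

(* x has the properties required of A_w.  The bound
   deg P_y <= (l(w) - l(y) - 1) / 2 is cleared of its denominator and
   subtraction; (size p).-1 is the degree of p <> 0, and for p = 0 the
   inequality holds because l(y) < l(w). *)
Definition is_A (M : lmodType Au) (a : W -> M) (M' : lmodType Av)
    (j : M -> M') (barM' : M' -> M') (w : W) (x : M') : Prop :=
  exists P : W -> {poly int},
    [/\ x = v ^ (- (len S w)%:Z) *:
            \sum_(y \in [set y | I y /\ bruhat_le S y w])
               j (zeval u (P y) *: a y),
        barM' x = x,
        P w = 1
      & forall y, I y -> bruhat_lt S y w ->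
          (2 * (size (P y)).-1 + len S y + 1 <= len S w)%N].

End Hecke.

(* Main.v *)
From HB Require Import structures.
From Stdlib Require Import Relation_Operators.
Require Import Defs.
From mathcomp Require Import all_boot all_order all_algebra finmap.
From mathcomp Require Import boolp classical_sets cardinality fsbigop.
From mathcomp Require Import zify ring.

(* The one delicate point is the shape of the bar operator on the basis a_w:
   bar a_w is a Z-combination of the u^k a_y with y <= w and
   - l(w) <= k <= - l(y), in which u^(- l(w)) a_w has coefficient 1.  This goes
   by induction on l(w): w is s w' s^* or s w' with w' shorter.  In the first
   case a_w = T_s a_w'; in the second (u + 1) a_w = T_s a_w' - u a_w', and the
   bound survives the division by u + 1 because M is free and bar a_w is known
   to lie in it.  The same induction shows that bar is an involution.  The y
   that occur stay below w by the lifting property of the Bruhat order, which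
   rests on the strong exchange condition.
   In the normalised basis v^(- l(w)) a_w bar is then unitriangular, so A_w is
   found by the Kazhdan-Lusztig argument: an element x with bar x = - x is
   split as p - bar p, p involving only negative powers of v, by peeling off
   the terms of maximal length; dually, a bar-invariant element involving only
   negative powers of v is 0.  The bounds on exponents above make the
   coefficients of A_w honest polynomials in u of the required degree. *)

Set Implicit Arguments.
Unset Strict Implicit.
Unset Printing Implicit Defensive.
Import Order.TTheory GRing.Theory Num.Theory.

(** * Laurent polynomials *)

Section LaurentCoefficients.
Local Open Scope ring_scope.
Variables (F : fieldType) (t : F).
Hypothesis t_tr : forall p, zeval t p = 0 -> p = 0.
Local Notation R := (laurent t).

Definition lgen : R := Laurent (laurent_gen t).

Lemma transcendental_neq0 : t != 0.
Proof.
apply/eqP => t0; have /eqP := @t_tr 'X (etrans (zevalX t) t0).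
by rewrite polyX_eq0.
Qed.

Lemma lgen_unit : lgen \is a GRing.unit.
Proof.
apply/andP; split; first exact: transcendental_neq0.
by apply/laurent_predP; exists 1, 1%N; rewrite /zeval rmorph1 hornerC expr1 div1r.
Qed.

(** Coefficients are extended by 0 to negative exponents, so that multiplying by a power of ['X] is
    a plain shift in [int]. *)
Definition coefz (p : {poly int}) (n : int) : int :=
  if n is Posz k then p`_k else 0.

Definition laurent_repr (x : R) (p : {poly int}) (n : nat) :=
  val x * t ^+ n = zeval t p.

Lemma laurent_reprP x : exists p n, laurent_repr x p n.
Proof.
have /laurent_predP[p [n e]] := valP x; exists p, n.
by rewrite /laurent_repr e divfK // expf_neq0 // transcendental_neq0.
Qed.

Lemma laurent_repr_num x : exists p : {poly int} * nat, laurent_repr x p.1 p.2.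
Proof. by have [p [n h]] := laurent_reprP x; exists (p, n). Qed.

(** The coefficient of [t ^ n] in [x], read off an arbitrarily chosen fraction [p / t ^ k]; [lcE]
    removes the choice. *)
Definition lc (n : int) (x : R) : int :=
  let p := projT1 (cid (laurent_repr_num x)) in coefz p.1 (n + p.2%:Z).

Lemma coefz_shift (p : {poly int}) k n :
  coefz (p * 'X^k) (n + k%:Z) = coefz p n.
Proof.
case: n => n /=; first by rewrite coefMXn ltnNge leq_addl /= addnK.
case e : (Negz n + k%:Z) => [m|m] //=; rewrite coefMXn.
by have -> : (m < k)%N by lia.
Qed.

(** Two fractions [p / t ^ k] and [q / t ^ m] for [x] give [p * 'X^m = q * 'X^k] after evaluation at
    [t], hence as polynomials, since [t] is transcendental. *)
Lemma lcE x p k : laurent_repr x p k -> forall n, lc n x = coefz p (n + k%:Z).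
Proof.
move=> xp n; rewrite /lc; case: cid => -[q m] /= xq.
have -> : coefz q (n + m%:Z) = coefz (q * 'X^k) (n + m%:Z + k%:Z).
  by rewrite coefz_shift.
have -> : coefz p (n + k%:Z) = coefz (p * 'X^m) (n + k%:Z + m%:Z).
  by rewrite coefz_shift.
rewrite addrAC; congr coefz; apply/eqP; rewrite -subr_eq0; apply/eqP/t_tr.
rewrite zevalB !zevalM !zevalXn -xp -xq.
by rewrite -!mulrA [t ^+ k * _]mulrC subrr.
Qed.

Lemma laurent_repr_up x p k m : laurent_repr x p k ->
  laurent_repr x (p * 'X^m) (k + m).
Proof.
by rewrite /laurent_repr exprD mulrA => ->; rewrite zevalM zevalXn.
Qed.

Lemma coefzB p q n : coefz (p - q) n = coefz p n - coefz q n.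
Proof. by case: n => n //=; rewrite ?coefB ?subr0. Qed.

Lemma lcB x y n : lc n (x - y) = lc n x - lc n y.
Proof.
have [p [k xp]] := laurent_reprP x; have [q [m yq]] := laurent_reprP y.
have {}xp := laurent_repr_up m xp; have {}yq := laurent_repr_up k yq.
rewrite addnC in yq; rewrite (lcE xp) (lcE yq).
rewrite (@lcE (x - y) (p * 'X^m - q * 'X^k) (k + m)) ?coefzB //.
by rewrite /laurent_repr zevalB -xp -yq mulrBl.
Qed.

HB.instance Definition _ n := GRing.isZmodMorphism.Build R int (lc n)
  (fun x y => lcB x y n).

Lemma val_lgenX n : val (lgen ^+ n) = t ^+ n.
Proof. by rewrite rmorphXn. Qed.

Lemma lc_mulX x (k : nat) n : lc n (lgen ^+ k * x) = lc (n - k%:Z) x.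
Proof.
have [p [m xp]] := laurent_reprP x; rewrite (lcE xp).
rewrite (@lcE _ (p * 'X^k) m).
  by rewrite -[n - _ + _]addrAC -{1}[n + m%:Z](subrK k%:Z) coefz_shift.
rewrite /laurent_repr zevalM zevalXn -xp.
by rewrite [val (_ * _)]rmorphM /= val_lgenX -mulrA mulrC.
Qed.

Lemma lgenXz_unit n : lgen ^ n \is a GRing.unit.
Proof. by case: n => n; rewrite /exprz ?unitrV unitrX // lgen_unit. Qed.

Lemma lc_mulXz x (k : int) n : lc n (lgen ^ k * x) = lc (n - k) x.
Proof.
case: k => k; first exact: lc_mulX.
rewrite NegzE opprK -[in RHS](@mulVKr _ (lgen ^+ k.+1) _ x); last first.
  by rewrite unitrX // lgen_unit.
by rewrite lc_mulX addrK.
Qed.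

Lemma lc1 n : lc n 1 = (n == 0)%:R.
Proof.
rewrite (@lcE _ 1 0); first by rewrite addr0; case: n => n //=; rewrite coef1.
by rewrite /laurent_repr expr0 mulr1 /zeval !rmorph1 hornerC.
Qed.

Lemma lc_genX k n : lc n (lgen ^ k) = (n == k)%:R.
Proof. by rewrite -[lgen ^ k]mulr1 lc_mulXz lc1 subr_eq0. Qed.

Lemma lc_inj x y : (forall n, lc n x = lc n y) -> x = y.
Proof.
move=> h; apply/eqP; rewrite -subr_eq0; apply/eqP.
have {}h n : lc n (x - y) = 0 by rewrite raddfB /= h subrr.
have [p [k e]] := laurent_reprP (x - y).
have p0 : p = 0.
  apply/polyP => i; rewrite coef0 -[p`_i]/(coefz p i) -(h (i%:Z - k%:Z)).
  by rewrite (lcE e) subrK.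
apply: val_inj; move: e; rewrite p0 /laurent_repr /zeval rmorph0 horner0 => /eqP.
by rewrite mulf_eq0 expf_eq0 (negbTE transcendental_neq0) andbF orbF => /eqP.
Qed.

Lemma laurent_expansion x : exists s : seq int,
  [/\ uniq s, forall n, (n \in s) = (lc n x != 0) &
      x = \sum_(n <- s) lgen ^ n *~ lc n x].
Proof.
have [p [k e]] := laurent_reprP x.
pose s := [seq i%:Z - k%:Z | i <- iota 0 (size p) & p`_i != 0].
have us : uniq s.
  rewrite map_inj_uniq ?filter_uniq ?iota_uniq // => i j /addIr [].
  by [].
have sE n : (n \in s) = (lc n x != 0).
  rewrite (lcE e); apply/mapP/idP => [[i]|].
    by rewrite mem_filter => /andP[pi _] ->; rewrite subrK.
  case en : (n + k%:Z) => [i|//] /= pi; exists i.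
    rewrite mem_filter pi mem_iota /= add0n ltnNge; apply: contra pi => sp.
    by rewrite nth_default.
  by rewrite -en addrK.
exists s; split=> //; apply: lc_inj => m; rewrite raddf_sum /=.
have E n : lc m (lgen ^ n *~ lc n x) = if n == m then lc m x else 0.
  rewrite raddfMz /= lc_genX eq_sym; case: eqP => [->|_]; last by rewrite mul0rz.
  by rewrite intz.
rewrite (eq_bigr _ (fun n _ => E n)) -big_mkcond.
have [ms|] := boolP (m \in s).
  by rewrite -big_filter (@perm_big _ _ _ _ _ [:: m]) ?big_seq1 //= filter_pred1_uniq.
move=> ms; have /negP := ms; rewrite sE => /negP; rewrite negbK => /eqP ->.
by rewrite big1.
Qed.

End LaurentCoefficients.

(** * Coordinates in free modules over Laurent polynomials *)

Section Coordinates.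
Local Open Scope ring_scope.
Variables (R : nzRingType) (V : lmodType R) (I : choiceType).
Variables (D : set I) (b : I -> V).

Lemma big_finsupp_widen (c : {fsfun I -> R with 0}) (s : {fset I}) :
  (finsupp c `<=` s)%fset ->
  \sum_(i <- finsupp c) c i *: b i = \sum_(i <- s) c i *: b i.
Proof.
move=> cs; apply: big_fset_incl => // i _ /fsfun_dflt ->.
by rewrite scale0r.
Qed.

Definition in_span (x : V) := exists (s : {fset I}) (f : I -> R),
  (forall i, i \in s -> D i) /\ x = \sum_(i <- s) f i *: b i.

Lemma in_span_basis i : D i -> in_span (b i).
Proof.
move=> Di; exists [fset i]%fset, (fun=> 1); rewrite big_seq_fset1 scale1r.
by split=> // j; rewrite inE => /eqP->.
Qed.

Lemma in_span0 : in_span 0.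
Proof.
exists fset0, (fun=> 0); rewrite big1 => [|i _]; last by rewrite scale0r.
by split=> // i; rewrite inE.
Qed.

Lemma in_spanZD k x y : in_span x -> in_span y -> in_span (k *: x + y).
Proof.
move=> [s [f [Ds ->]]] [s' [f' [Ds' ->]]].
exists ((s `|` s')%fset), (fun i => k * (if i \in s then f i else 0)
  + if i \in s' then f' i else 0); split=> [i|].
  by rewrite inE => /orP[/Ds|/Ds'].
have widen q h : (q `<=` s `|` s')%fset -> \sum_(i <- q) h i *: b i =
    \sum_(i <- (s `|` s')%fset) (if i \in q then h i else 0) *: b i.
  move=> qs; rewrite (eq_big_seq (fun i => (if i \in q then h i else 0) *: b i)).
    by apply: big_fset_incl => // i _ /negbTE->; rewrite scale0r.
  by move=> i ->.
rewrite (widen s) ?fsubsetUl // (widen s') ?fsubsetUr // scaler_sumr -big_split /=.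
by apply: eq_bigr => i _; rewrite scalerA scalerDl.
Qed.

(** Spanning gives a finitely supported family of coefficients; two such families are compared on
    the union of their supports, where independence makes them equal. *)
Lemma is_basisI : (forall x, in_span x) ->
  (forall (c : I -> R) (s : {fset I}), (forall i, i \in s -> D i) ->
    \sum_(i <- s) c i *: b i = 0 -> forall i, i \in s -> c i = 0) ->
  is_basis D b.
Proof.
move=> spn ind x; have [s [f [Df xf]]] := spn x.
pose c := [fsfun i in s => f i | 0] : {fsfun I -> R with 0}.
have cs : (finsupp c `<=` s)%fset by exact: finsupp_sub.
have Dc i : i \in finsupp c -> D i by move/(fsubsetP cs)/Df.
have xc : x = \sum_(i <- finsupp c) c i *: b i.
  rewrite (big_finsupp_widen cs) xf; apply: eq_big_seq => i si.
  by rewrite fsfunE si.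
exists c; split=> // c' [Dc' xc'].
have Ds i : i \in (finsupp c `|` finsupp c')%fset -> D i.
  by rewrite inE => /orP[/Dc|/Dc'].
have := ind (fun i => c i - c' i) _ Ds; under eq_bigr do rewrite scalerBl.
rewrite sumrB -(big_finsupp_widen (fsubsetUl _ _)).
rewrite -(big_finsupp_widen (fsubsetUr _ _)) -xc -xc' subrr.
move=> /(_ erefl) cc; apply/fsfunP => i; apply/eqP; rewrite -subr_eq0.
have [/cc->//|] := boolP (i \in (finsupp c `|` finsupp c')%fset).
by rewrite inE negb_or => /andP[/fsfun_dflt-> /fsfun_dflt->]; rewrite subrr.
Qed.

Hypothesis Hb : is_basis D b.

Definition bcoord (i : I) (x : V) : R := projT1 (cid (Hb x)) i.

Lemma bcoord_expand x : exists s : {fset I},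
  [/\ forall i, i \in s -> D i, forall i, (i \in s) = (bcoord i x != 0) &
      x = \sum_(i <- s) bcoord i x *: b i].
Proof.
rewrite /bcoord; case: cid => c [[Dc xc] _] /=; exists (finsupp c); split=> //.
by move=> i; rewrite mem_finsupp.
Qed.

Lemma bcoord_uniq (f : I -> R) (s : {fset I}) : (forall i, i \in s -> D i) ->
  forall i, bcoord i (\sum_(i <- s) f i *: b i) = if i \in s then f i else 0.
Proof.
move=> Ds i; rewrite /bcoord; case: cid => c [[Dc xc] cuniq] /=.
pose c' := [fsfun i in s => f i | 0] : {fsfun I -> R with 0}.
have sc' : (finsupp c' `<=` s)%fset by exact: finsupp_sub.
rewrite (cuniq c') ?fsfunE //; split=> [j|].
  by move/fsubsetP: sc' => h /h /Ds.
rewrite (big_finsupp_widen sc'); apply: eq_big_seq => j js.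
by rewrite fsfunE js.
Qed.

Lemma bcoord_out i x : ~ D i -> bcoord i x = 0.
Proof.
move=> nDi; have [s [Ds sE _]] := bcoord_expand x.
by apply/eqP/negPn/negP; rewrite -sE => /Ds.
Qed.

Lemma bcoord_zmod i : zmod_morphism (bcoord i).
Proof.
move=> x y; have [s [Ds sE xs]] := bcoord_expand x.
have [s' [Ds' sE' ys]] := bcoord_expand y.
pose r := (s `|` s')%fset.
have Dr j : j \in r -> D j by rewrite inE => /orP[/Ds|/Ds'].
have widen z (q : {fset I}) :
    (q `<=` r)%fset -> (forall i, (i \in q) = (bcoord i z != 0)) ->
    z = \sum_(i <- q) bcoord i z *: b i -> z = \sum_(i <- r) bcoord i z *: b i.
  move=> qr qE {1}->; apply: big_fset_incl => // j _; rewrite qE negbK => /eqP->.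
  by rewrite scale0r.
rewrite {1}(widen x s) ?fsubsetUl // {1}(widen y s') ?fsubsetUr // -sumrB.
under eq_bigr do rewrite -scalerBl.
rewrite bcoord_uniq //; case: ifPn => //.
by rewrite inE negb_or sE sE' !negbK => /andP[/eqP-> /eqP->]; rewrite subrr.
Qed.
HB.instance Definition _ i :=
  GRing.isZmodMorphism.Build V R (bcoord i) (bcoord_zmod i).

Lemma bcoordZ i k x : bcoord i (k *: x) = k * bcoord i x.
Proof.
have [s [Ds sE {1}->]] := bcoord_expand x; rewrite scaler_sumr.
under eq_bigr do rewrite scalerA.
by rewrite bcoord_uniq // sE; case: eqP => //= ->; rewrite mulr0.
Qed.

Lemma bcoord_basis i j : D i -> bcoord j (b i) = (j == i)%:R.
Proof.
move=> Di; have := @bcoord_uniq (fun=> 1) [fset i]%fset _ j.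
rewrite big_seq_fset1 scale1r inE => ->; first by case: eqP.
by move=> k; rewrite inE => /eqP->.
Qed.

End Coordinates.

(** * Integer coordinates in a free module over Laurent polynomials *)

Section LaurentModule.
Local Open Scope ring_scope.
Variables (F : fieldType) (t : F).
Hypothesis t_tr : forall p, zeval t p = 0 -> p = 0.
Local Notation R := (laurent t).
Local Notation g := (lgen t).
Variables (V : lmodType R) (I : choiceType) (D : set I) (b : I -> V).
Hypothesis Hb : is_basis D b.

(** The monomials [g ^ n *: b i] are a basis over the integers. The bar operators are additive but
    not linear, so they are studied through these integer coordinates. *)
Definition cf (i : I) (n : int) (x : V) : int := lc t_tr n (bcoord Hb i x).

Lemma cf_zmod i n : zmod_morphism (cf i n).
Proof. by move=> x y; rewrite /cf !raddfB. Qed.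
HB.instance Definition _ i n :=
  GRing.isZmodMorphism.Build V int (cf i n) (cf_zmod i n).

Lemma cf0 i n : cf i n 0 = 0.
Proof. exact: raddf0. Qed.

Lemma cfN i n x : cf i n (- x) = - cf i n x.
Proof. exact: raddfN. Qed.

Lemma cfD i n x y : cf i n (x + y) = cf i n x + cf i n y.
Proof. exact: raddfD. Qed.

Lemma cf_shift i n k x : cf i n (g ^ k *: x) = cf i (n - k) x.
Proof. by rewrite /cf bcoordZ lc_mulXz. Qed.

Lemma cf_basis i j n : D i -> cf j n (b i) = ((j == i) && (n == 0))%:R.
Proof.
move=> Di; rewrite /cf bcoord_basis //; case: eqP => _ /=; first exact: lc1.
by rewrite raddf0.
Qed.

Lemma cf_monom i k j n : D i ->
  cf j n (g ^ k *: b i) = ((j == i) && (n == k))%:R.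
Proof. by move=> Di; rewrite cf_shift cf_basis // subr_eq0. Qed.

Lemma cf_dom i n x : cf i n x != 0 -> D i.
Proof.
by move=> h; apply: contrapT => /(bcoord_out Hb) e; rewrite /cf e raddf0 eqxx in h.
Qed.

Lemma cf_expand x : exists s : seq (I * int),
  [/\ uniq s, forall i n, ((i, n) \in s) = (cf i n x != 0) &
      x = \sum_(p <- s) (g ^ p.2 *: b p.1) *~ cf p.1 p.2 x].
Proof.
have [s [Ds sE xs]] := bcoord_expand Hb x.
have /choice[e eP] : forall i, exists e : seq int,
  [/\ uniq e, forall n, (n \in e) = (cf i n x != 0) &
      bcoord Hb i x = \sum_(n <- e) g ^ n *~ cf i n x].
  by move=> i; exact: laurent_expansion.
exists [seq (i, n) | i <- s, n <- e i]; split.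
- apply: allpairs_uniq_dep => //; first by move=> i _; case: (eP i).
  by move=> [i m] [j n] _ _ [-> ->].
- move=> i n; apply/allpairsPdep/idP => [[j [m [_ + [-> ->]]]]|nz].
    by case: (eP j) => _ -> _.
  exists i, n; split=> //; last by case: (eP i) => _ -> _.
  by rewrite sE; apply: contraNneq nz => c0; rewrite /cf c0 raddf0.
rewrite big_allpairs_dep {1}xs; apply: eq_bigr => i _; case: (eP i) => _ _ ->.
by rewrite scaler_suml; apply: eq_bigr => n _; rewrite scalerMzl.
Qed.

(** Reduces an additive statement to monomials. Only monomials that occur in [x] need be treated, so
    a bound on the support of [x] can be used for each of them. *)
Lemma cf_ind (P : V -> Prop) x : P 0 -> (forall y z, P y -> P z -> P (y - z)) ->
  (forall i n, D i -> cf i n x != 0 -> P (g ^ n *: b i)) -> P x.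
Proof.
move=> P0 PB Pm; have [s [_ sE ->]] := cf_expand x.
have PN y : P y -> P (- y) by move=> Py; rewrite -[- y]sub0r; exact: PB.
have PD y z : P y -> P z -> P (y + z).
  by move=> Py Pz; rewrite -[z]opprK; apply: PB => //; exact: PN.
have PMn y n : P y -> P (y *+ n).
  by move=> Py; elim: n => [|n IH]; rewrite ?mulr0n // mulrS; exact: PD.
rewrite big_seq; elim/big_ind: _ => // -[i n]; rewrite sE => nz.
have := Pm i n (cf_dom nz) nz; set m := g ^ n *: b i => Pmn.
by case: (cf i n x) => k; [apply: PMn|rewrite NegzE mulrNz; apply/PN/PMn].
Qed.

Lemma cf_inj x y : (forall i n, cf i n x = cf i n y) -> x = y.
Proof.
move=> h; apply/eqP; rewrite -subr_eq0; apply/eqP.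
apply: (@cf_ind (fun z => z = 0)) => // [_ _ -> ->|i n _]; first exact: subrr.
by rewrite raddfB /= h subrr eqxx.
Qed.

Definition cf_supp (Q : I -> int -> Prop) x := forall i n, cf i n x != 0 -> Q i n.

Lemma cf_supp0 Q : cf_supp Q 0.
Proof. by move=> i n; rewrite cf0 eqxx. Qed.

Lemma cf_suppB Q x y : cf_supp Q x -> cf_supp Q y -> cf_supp Q (x - y).
Proof.
move=> Qx Qy i n; rewrite cfD cfN; have [->|/Qx//] := eqVneq (cf i n x) 0.
by rewrite sub0r oppr_eq0 => /Qy.
Qed.

Lemma cf_suppN Q x : cf_supp Q x -> cf_supp Q (- x).
Proof. by move=> Qx i n; rewrite cfN oppr_eq0 => /Qx. Qed.

Lemma cf_suppD Q x y : cf_supp Q x -> cf_supp Q y -> cf_supp Q (x + y).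
Proof. by move=> Qx Qy; rewrite -[y]opprK; exact: cf_suppB Qx (cf_suppN Qy). Qed.

Lemma cf_supp_monom (Q : I -> int -> Prop) i k :
  D i -> Q i k -> cf_supp Q (g ^ k *: b i).
Proof.
move=> Di Qi j n; rewrite cf_monom //.
by case: (j =P i) => [->|_]; case: (n =P k) => [->|_].
Qed.

End LaurentModule.

Arguments cf_supp0 {F t t_tr V I D b Hb Q}.
Arguments cf_supp_monom {F t t_tr V I D b Hb Q i k}.

(** * Coxeter groups and the Bruhat order *)

Section ConjugationCocycle.
Local Open Scope group_scope.
Variable W : groupType.

(** With the product below this is the semidirect product of the subsets of [W], under symmetric
    difference, with [W] acting by conjugation. *)
Definition cocycle : Type := ((W -> bool) * W)%type.
HB.instance Definition _ := Choice.on cocycle.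

Definition cocycle_mul (x y : cocycle) : cocycle :=
  (fun t => x.1 t (+) y.1 (x.2^-1 * t * x.2), x.2 * y.2).
Definition cocycle_one : cocycle := (fun=> false, 1).
Definition cocycle_inv (x : cocycle) : cocycle :=
  (fun t => x.1 (x.2 * t * x.2^-1), x.2^-1).

Lemma cocycle_mulA : associative cocycle_mul.
Proof.
move=> [f x] [g y] [h z]; congr (_, _) => /=; last by rewrite mulgA.
by apply/funext => t; rewrite addbA invgM !mulgA.
Qed.
Lemma cocycle_mul1 : left_id cocycle_one cocycle_mul.
Proof.
move=> [f x]; congr (_, _) => /=; last by rewrite mul1g.
by apply/funext => t; rewrite invg1 mul1g mulg1.
Qed.
Lemma cocycle_mulr1 : right_id cocycle_one cocycle_mul.
Proof.
by move=> [f x]; congr (_, _) => /=; rewrite ?mulg1 //; apply/funext => t;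
  rewrite addbF.
Qed.
Lemma cocycle_mulV : left_inverse cocycle_one cocycle_inv cocycle_mul.
Proof.
move=> [f x]; congr (_, _) => /=; last by rewrite mulVg.
by apply/funext => t; rewrite invgK addbb.
Qed.
Lemma cocycle_mulrV : right_inverse cocycle_one cocycle_inv cocycle_mul.
Proof.
move=> [f x]; congr (_, _) => /=; last by rewrite mulgV.
by apply/funext => t; rewrite !mulgA mulgV mul1g -mulgA mulgV mulg1 addbb.
Qed.
HB.instance Definition _ := isGroup.Build cocycle cocycle_mulA
  cocycle_mul1 cocycle_mulr1 cocycle_mulV cocycle_mulrV.

Lemma cocycle_mul1E (x y : cocycle) t :
  (x * y).1 t = x.1 t (+) y.1 (x.2^-1 * t * x.2).
Proof. by []. Qed.

Lemma cocycle_mul2E (x y : cocycle) : (x * y).2 = x.2 * y.2.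
Proof. by []. Qed.

Lemma cocycle_exp2E (x : cocycle) n : (x ^+ n).2 = x.2 ^+ n.
Proof. by elim: n => [//|n IH]; rewrite !expgS cocycle_mul2E IH. Qed.

(** The word [s t s t ...] with [2n] letters produces the elements [(s t)^i s] for [i < 2n], and the
    first component counts them modulo 2. This serves to check the Coxeter relations in
    [cocycle]. *)
Lemma cocycle_expE (s t : W) n r : s * s = 1 -> t * t = 1 ->
  let f x : cocycle := (fun y => y == x, x) in
  ((f s * f t) ^+ n).1 r
     = \big[addb/false]_(0 <= i < n + n) (r == (s * t) ^+ i * s).
Proof.
move=> ss tt f; have sV : s^-1 = s by rewrite -[s^-1]mulg1 -ss mulKg.
have tV : t^-1 = t by rewrite -[t^-1]mulg1 -tt mulKg.
have Ks x : x * s * s = x by rewrite -mulgA ss mulg1.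
have Kt x : x * t * t = x by rewrite -mulgA tt mulg1.
elim: n r => [|n IH] r; first by rewrite big_geq.
rewrite expgS cocycle_mul1E IH cocycle_mul1E /=.
rewrite addnS addSn !big_nat_recl // expg0 mul1g expg1 addbA; congr (_ (+) _).
  congr (_ (+) _); rewrite sV; apply/eqP/eqP => [<-|->].
    by rewrite !mulgA Ks ss mul1g.
  by rewrite !mulgA Ks ss mul1g.
apply: eq_bigr => i _; rewrite invgM sV tV.
(* Conjugation by [s * t] raises the index by 2, which makes room for the two terms of the new
   factor. *)
have -> : (s * t) ^+ i.+2 * s = s * t * ((s * t) ^+ i * s) * (t * s).
  by rewrite expgS expgSr !mulgA.
apply/eqP/eqP => [<-|->]; rewrite !mulgA.
  by rewrite !Kt ss mul1g Ks.
by rewrite !Ks tt mul1g Kt.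
Qed.
End ConjugationCocycle.

(** * Length, strong exchange and the Bruhat order *)

Section CoxeterGroup.
Local Open Scope group_scope.
Variables (W : groupType) (S : set W) (cox : coxeter_system S).
Implicit Types (w x y z s t : W) (e : seq W).

Lemma simple_sqr s : S s -> s * s = 1.
Proof. by move=> /(cox_order2 cox)[]. Qed.

Lemma simple_inv s : S s -> s^-1 = s.
Proof. by move=> /simple_sqr ss; rewrite -[s^-1]mulg1 -ss mulKg. Qed.

Lemma simpleK s w : S s -> s * (s * w) = w.
Proof. by move=> /simple_sqr ss; rewrite mulgA ss mul1g. Qed.

Lemma simpleKr s w : S s -> w * s * s = w.
Proof. by move=> /simple_sqr ss; rewrite -mulgA ss mulg1. Qed.

Lemma is_word_cons s e w : S s -> is_word S w e -> is_word S (s * w) (s :: e).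
Proof.
move=> Ss [Se ->]; split; last by rewrite big_cons.
by move=> r; rewrite inE => /orP[/eqP->|/Se].
Qed.

Lemma is_word_consP s e w : is_word S w (s :: e) ->
  [/\ S s, is_word S (s * w) e & is_word S (s^-1 * w) e].
Proof.
move=> [Se ->]; have Ss : S s by apply: Se; rewrite mem_head.
rewrite big_cons (simple_inv Ss) simpleK //.
have h : is_word S (\prod_(i <- e) i) e.
  by split=> // r re; apply: Se; rewrite inE re orbT.
by split.
Qed.

Lemma is_word_cat w x e1 e2 :
  is_word S w e1 -> is_word S x e2 -> is_word S (w * x) (e1 ++ e2).
Proof.
move=> [S1 ->] [S2 ->]; rewrite -big_cat; split=> // s.
by rewrite mem_cat => /orP[/S1|/S2].
Qed.

Lemma is_word_rev w e : is_word S w e -> is_word S w^-1 (rev e).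
Proof.
elim: e w => [|s e IH] w.
  by case=> _ ->; rewrite big_nil invg1; split=> //; rewrite big_nil.
case/is_word_consP => Ss /IH h _; rewrite rev_cons -cats1.
have -> : w^-1 = (s * w)^-1 * s by rewrite invgM (simple_inv Ss) simpleKr.
apply: is_word_cat => //; split; last by rewrite big_seq1.
by move=> r; rewrite inE => /eqP->.
Qed.

Lemma lenP w : (exists2 e, is_word S w e & size e = len S w) /\
  (forall e, is_word S w e -> (len S w <= size e)%N).
Proof.
rewrite /len; case: xgetP => [n -> [[e we <-] emin]|noex].
  by split=> //; exists e.
have [e0 we0] := cox_gen cox w.
pose P n := `[< exists2 e, is_word S w e & size e = n >].
have exP : exists n, P n by exists (size e0); apply/asboolP; exists e0.
case: (ex_minnP exP) => m /asboolP Pm mmin; case: (noex m); split=> // e we.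
by apply: mmin; apply/asboolP; exists e.
Qed.

Lemma reduced_word w : exists2 e, is_word S w e & size e = len S w.
Proof. by case: (lenP w). Qed.

Lemma len_le_word w e : is_word S w e -> (len S w <= size e)%N.
Proof. by case: (lenP w) => _; apply. Qed.

Lemma len1 : len S 1 = 0%N.
Proof.
apply/eqP; rewrite -leqn0 -[leqRHS]/(size ([::] : seq W)); apply: len_le_word.
by split=> //; rewrite big_nil.
Qed.

Lemma len_eq0 w : len S w = 0%N -> w = 1.
Proof.
move=> w0; case: (reduced_word w) => e [_ we]; rewrite w0 => /size0nil e0.
by rewrite we e0 big_nil.
Qed.

Lemma len_inv w : len S w^-1 = len S w.
Proof.
suff h x : (len S x^-1 <= len S x)%N.
  by apply/eqP; rewrite eqn_leq h -{1}[w]invgK h.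
case: (reduced_word x) => e /is_word_rev xe <-; rewrite -size_rev.
exact: len_le_word.
Qed.

Lemma len_simple_le s w : S s -> (len S (s * w) <= (len S w).+1)%N.
Proof.
move=> Ss; case: (reduced_word w) => e we <-.
exact: (len_le_word (is_word_cons Ss we)).
Qed.

Lemma left_descent w : w <> 1 -> exists2 s, S s & (len S (s * w) < len S w)%N.
Proof.
case: (reduced_word w) => [[|s e]] we <-.
  by case: we => _ ->; rewrite big_nil.
by case: (is_word_consP we) => Ss swe _; exists s => //; exact: (len_le_word swe).
Qed.

(* N w is the indicator of the set of reflections t with
   len (t * w) < len w.  It is obtained from the morphism that sends each
   simple s to the pair ([set s], s) of the semidirect product cocycle W. *)
Lemma reflection_cocycle : exists N : W -> W -> bool,
  [/\ forall s t, S s -> N s t = (t == s), forall t, N 1 t = false &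
      forall x y t, N (x * y) t = N x t (+) N y (x^-1 * t * x)].
Proof.
pose f s : cocycle W := (fun y => y == s, s).
have [|phi phiE] := @cox_pres _ _ cox (cocycle W) f.
  move=> s t n Ss St stn; rewrite [LHS]surjective_pairing.
  congr (_, _); last by rewrite cocycle_exp2E.
  apply/funext => r; rewrite cocycle_expE ?simple_sqr //.
  (* As [(s * t) ^+ n = 1], the second half of the sum repeats the first and cancels it modulo 2. *)
  rewrite (@big_cat_nat _ _ _ n) ?leq_addr //=.
  rewrite [X in _ (+) X](_ : _ =
    \big[addb/false]_(0 <= i < n) (r == (s * t) ^+ i * s)) ?addbb //.
  rewrite -{1}[n]add0n big_addn addnK; apply: eq_bigr => i _.
  by rewrite expgnDr stn mulg1.
have phi1 : phi 1 = 1.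
  by apply: (@mulgI _ (phi 1)); rewrite -gmulfM !mulg1.
have phi2 w : (phi w).2 = w.
  case: (cox_gen cox w) => e; elim: e w => [|s e IH] w.
    by case=> _ ->; rewrite big_nil phi1.
  case/is_word_consP => Ss /IH h _; rewrite -{1}(simpleK w Ss) gmulfM.
  by rewrite cocycle_mul2E h phiE //= simpleK.
exists (fun w => (phi w).1); split=> [s t Ss|t|x y t].
- by rewrite phiE.
- by rewrite phi1.
- by rewrite gmulfM cocycle_mul1E phi2.
Qed.

Lemma reflection_inv t : reflection S t -> t^-1 = t.
Proof.
by case=> s [x [Ss ->]]; rewrite !invgM invgK (simple_inv Ss) mulgA.
Qed.

Lemma reflectionK t w : reflection S t -> t * (t * w) = w.
Proof. by move=> /reflection_inv tV; rewrite -{1}tV mulKg. Qed.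

Lemma reflection_conj t x : reflection S t -> reflection S (x * t * x^-1).
Proof.
by case=> s [y [Ss ->]]; exists s, (x * y); rewrite invgM !mulgA.
Qed.

Lemma reflection_simple s : S s -> reflection S s.
Proof. by move=> Ss; exists s, 1; rewrite invg1 mul1g mulg1. Qed.

(* The strong exchange condition. *)
Lemma reflection_len t w : reflection S t ->
  ((len S w < len S (t * w))%N \/ (len S (t * w) < len S w)%N) /\
  ((len S (t * w) <= len S w)%N -> forall e, is_word S w e ->
    exists e1 s e2, e = e1 ++ s :: e2 /\ is_word S (t * w) (e1 ++ e2)).
Proof.
case: reflection_cocycle => N [Ns N1 NM] rt.
(* For [t = x * s * x^-1] the contributions of [x] and [x^-1] cancel because [N (x * x^-1)]
   vanishes; the letter [s] contributes once. *)
have Nt : N t t.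
  case: rt => s [x [Ss ->]].
  have := N1 (x * s * x^-1); rewrite -(mulgV x) NM.
  have -> : x^-1 * (x * s * x^-1) * x = s by rewrite -!mulgA mulVg mulg1 mulKg.
  rewrite !NM (Ns s _ Ss).
  have -> : x^-1 * (x * s * x^-1) * x = s by rewrite -!mulgA mulVg mulg1 mulKg.
  rewrite invgM (simple_inv Ss) eqxx.
  have -> : s * x^-1 * (x * s * x^-1) * (x * s) = s.
    by rewrite -!mulgA !mulKg simpleK.
  by case: (N x _); case: (N _ s).
(* By the cocycle rule, if [r] is the first letter it is deleted; otherwise [r] is conjugated by
   that letter and the search goes on in the rest of the word. *)
have exch e x r : is_word S x e -> N x r ->
    exists e1 s e2, e = e1 ++ s :: e2 /\ is_word S (r * x) (e1 ++ e2).
  elim: e x r => [|s e IH] x r; first by case=> _ ->; rewrite big_nil N1.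
  case/is_word_consP => Ss we _; rewrite -[in N x](simpleK x Ss) NM (Ns s _ Ss).
  case: eqP => [-> _|_ /=]; first by exists [::], s, e.
  move=> /(IH _ _ we)[e1 [s' [e2 [-> h]]]]; exists (s :: e1), s', e2; split=> //=.
  move: h => /(is_word_cons Ss); congr is_word.
  by rewrite !mulgA (simple_inv Ss) simple_sqr // mul1g -(mulgA r) simple_sqr // mulg1.
have desc x : N x t -> (len S (t * x) < len S x)%N.
  move=> Nx; case: (reduced_word x) => e we <-.
  have [e1 [s [e2 [-> /len_le_word h]]]] := exch _ _ _ we Nx.
  by rewrite (leq_ltn_trans h) // !size_cat /= addnS.
(* Hence [t] shortens exactly one of [x] and [t * x], which yields the dichotomy of lengths. *)
have NtM x : N (t * x) t = ~~ N x t.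
  by rewrite NM Nt mulVg mul1g.
case Nw : (N w t).
  by split=> [|_ e we]; [right; exact: desc|exact: exch].
have : (len S w < len S (t * w))%N.
  by rewrite -{1}(reflectionK w rt); apply: desc; rewrite NtM Nw.
by move=> lt; split; [left|rewrite leqNgt lt].
Qed.

Lemma simple_len s w : S s ->
  len S (s * w) = (len S w).+1 \/ len S w = (len S (s * w)).+1.
Proof.
move=> Ss; have := len_simple_le w Ss; have := len_simple_le (s * w) Ss.
rewrite simpleK //; have [[] h _] := reflection_len w (reflection_simple Ss); lia.
Qed.

Lemma simple_len_r s w : S s ->
  len S (w * s) = (len S w).+1 \/ len S w = (len S (w * s)).+1.
Proof.
move=> Ss; rewrite -(len_inv (w * s)) -(len_inv w) invgM (simple_inv Ss).
exact: simple_len.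
Qed.

(* If both s and r lengthen z, the exchange condition applied to s z shows that
   r can only shorten s z by undoing s. *)
Lemma len_double s z r : S s -> S r ->
  len S (s * z) = (len S z).+1 -> len S (z * r) = (len S z).+1 ->
  s * z = z * r \/ len S (s * z * r) = (len S z).+2.
Proof.
move=> Ss Sr lsz lzr.
have [szr|/negP szr] := leqP (len S (s * z * r)) (len S (s * z)).
  left; have rt := reflection_conj (s * z) (reflection_simple Sr).
  have eq : s * z * r * (s * z)^-1 * (s * z) = s * z * r.
    by rewrite -mulgA mulVg mulg1.
  case: (reduced_word z) => e we sze; have := is_word_cons Ss we.
  have [_] := reflection_len (s * z) rt; rewrite eq => /(_ szr) h /h.
  (* Deleting the first letter gives [s * z * r = z]; deleting a later one would give [z * r] a word
     shorter than a reduced word of [z]. *)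
  case=> -[|s' e1] [s0 [e2 [[]]]].
    move=> _ <- [_ h1]; case: we h1 => _ <- szrz.
    by rewrite -[in RHS]szrz simpleKr.
  move=> <-{s'} ee; rewrite cat_cons => /is_word_consP[_].
  rewrite -!mulgA simpleK // => /len_le_word.
  by rewrite lzr -sze ee !size_cat /= addnS ltnNge leqnSn.
by right; case: (simple_len_r (s * z) Sr); lia.
Qed.

Local Notation "x <=B y" := (bruhat_le S x y) (at level 70).

Lemma bruhat_refl w : w <=B w.
Proof. exact: rt_refl. Qed.

Lemma bruhat_trans x y z : x <=B y -> y <=B z -> x <=B z.
Proof. exact: rt_trans. Qed.

Lemma bruhat_reflection t w : reflection S t -> (len S w < len S (t * w))%N ->
  w <=B t * w.
Proof.
move=> rt lw; apply: rt_step; exists (w^-1 * t * w); split=> //.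
  by rewrite -{2}[w]invgK; exact: reflection_conj.
by rewrite !mulgA mulgV mul1g.
Qed.

(* Same relation, with reflections multiplied on the left. *)
Lemma bruhat_ind (P : W -> W -> Prop) :
  (forall w, P w w) -> (forall x y z, P x y -> P y z -> P x z) ->
  (forall t w, reflection S t -> (len S w < len S (t * w))%N -> P w (t * w)) ->
  forall y w, y <=B w -> P y w.
Proof.
move=> P1 PT Pt y w; elim=> {y w} [y w [t [rt -> lw]]|//|x y z _ + _]; last exact: PT.
have -> : y * t = y * t * y^-1 * y by rewrite -mulgA mulVg mulg1.
apply: Pt; first exact: reflection_conj.
by rewrite -[y * t * y^-1 * y]mulgA mulVg mulg1.
Qed.

Lemma bruhat_len y w : y <=B w -> y = w \/ (len S y < len S w)%N.
Proof.
elim/bruhat_ind: y w / => [w|x y z [->//|h1] [<-|h2]|t w _ h]; try by [left|right].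
by right; exact: ltn_trans h2.
Qed.

Lemma bruhat_len_le y w : y <=B w -> (len S y <= len S w)%N.
Proof. by case/bruhat_len => [->//|/ltnW]. Qed.

Lemma bruhat_inv y w : y <=B w -> y^-1 <=B w^-1.
Proof.
elim/bruhat_ind: y w / => [w|x y z|t w rt h]; first exact: bruhat_refl.
  exact: bruhat_trans.
apply: rt_step; exists t; rewrite invgM (reflection_inv rt) len_inv; split=> //.
by rewrite -[t in w^-1 * t](reflection_inv rt) -invgM len_inv.
Qed.

Lemma bruhat_simple s w : S s -> (len S w < len S (s * w))%N -> w <=B s * w.
Proof. by move=> Ss; exact: bruhat_reflection (reflection_simple Ss). Qed.

Lemma bruhat_simple_r s w : S s -> (len S w < len S (w * s))%N -> w <=B w * s.
Proof.
by move=> Ss lw; apply: rt_step; exists s; split=> //; exact: reflection_simple.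
Qed.

(** For one step [w < t * w] with [s * w > w], compare [s * w] with [s * t * w]. If the latter is
    not longer, exchange applies to [s] followed by a reduced word of [w]: deleting [s] gives
    [t * w = s * w], and deleting a later letter would make [t * w] shorter than [w]. *)
Lemma bruhat_lift s y w : S s -> y <=B w -> s * y <=B w \/ s * y <=B s * w.
Proof.
(* The conjunct [y <=B w] is carried along because composing two steps uses it. *)
move=> Ss yw; suff [] : y <=B w /\ (s * y <=B w \/ s * y <=B s * w) by [].
elim/bruhat_ind: y w / yw => [w|x y z [xy sxy] [yz syz]|t w rt lw].
- by split; [|right]; exact: bruhat_refl.
- split; first exact: bruhat_trans yz.
  case: sxy => sxy; first by left; exact: bruhat_trans yz.
  by case: syz => syz; [left|right]; exact: bruhat_trans syz.
have wtw := bruhat_reflection rt lw; split=> //.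
case: (simple_len w Ss) => lsw; last first.
  left; apply: bruhat_trans wtw.
  by rewrite -{2}(simpleK w Ss); apply: bruhat_simple => //; rewrite simpleK // lsw.
have rst := reflection_conj s rt.
have stw : s * t * s^-1 * (s * w) = s * (t * w) by rewrite -!mulgA mulKg.
have [] := reflection_len (s * w) rst; rewrite stw => -[h _|/ltnW h /(_ h) exch].
  by right; rewrite -stw; apply: bruhat_reflection => //; rewrite stw.
left; case: (reduced_word w) => e we sze.
have [[|s' e1] [s0 [e2 []]]] := exch _ (is_word_cons Ss we).
  move=> [_ <-] [_ stwe]; case: we => _ we.
  have -> : t * w = s * w by rewrite -[LHS](simpleK _ Ss) stwe [in RHS]we.
  exact: bruhat_refl.
move=> [<- ee]; rewrite cat_cons => /is_word_consP[_].
rewrite simpleK // => /len_le_word; move: lw; rewrite -sze ee !size_cat /= => l1 l2 _.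
by move: (leq_trans l1 l2); rewrite addnS ltnNge leqnSn.
Qed.

Lemma bruhat_lift_up s y w : S s -> (len S w < len S (s * w))%N ->
  y <=B w -> s * y <=B s * w.
Proof.
move=> Ss lw /(bruhat_lift Ss)[h|//].
exact: bruhat_trans (bruhat_simple Ss lw).
Qed.

Lemma bruhat_lift_r s y w : S s -> y <=B w -> y * s <=B w \/ y * s <=B w * s.
Proof.
move=> Ss /bruhat_inv /(bruhat_lift Ss) h.
have inv x : x * s = (s * x^-1)^-1 by rewrite invgM invgK (simple_inv Ss).
by rewrite !inv -{1}[w]invgK; case: h => /bruhat_inv; [left|right].
Qed.

Lemma bruhat_lift_up_r s y w : S s -> (len S w < len S (w * s))%N ->
  y <=B w -> y * s <=B w * s.
Proof.
move=> Ss; rewrite -(len_inv w) -(len_inv (w * s)) invgM (simple_inv Ss).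
move=> lw /bruhat_inv /(bruhat_lift_up Ss lw) /bruhat_inv.
by rewrite !invgM !invgK (simple_inv Ss).
Qed.

(** Each downward step deletes one letter, by strong exchange. Lower intervals are therefore finite:
    a word has finitely many subwords. *)
Lemma bruhat_subword y w e : y <=B w -> is_word S w e ->
  exists2 e', subseq e' e & is_word S y e'.
Proof.
move=> yw; elim/bruhat_ind: y w / yw e => [w|x y z IHx IHy|t w rt lw] e we.
- by exists e.
- have [e1 s1 /IHx[e2 s2 xe]] := IHy _ we; exists e2 => //.
  exact: subseq_trans s1.
- have [_] := reflection_len (t * w) rt; rewrite (reflectionK w rt) => /(_ (ltnW lw)).
  move=> /(_ e we)[e1 [s [e2 [-> we']]]]; exists (e1 ++ e2) => //.
  by rewrite cat_subseq // subseq_cons.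
Qed.

Lemma bruhat_finite w : finite_set [set y | y <=B w].
Proof.
have [e we _] := reduced_word w.
pose f (m : (size e).-tuple bool) : W := \prod_(s <- mask m e) s.
apply: (@sub_finite_set _ _ (f @` setT)); last first.
  by apply: finite_image; exact: finite_finset.
move=> y /= yw; have [e' /subseqP[m sm ->] [_ ->]] := bruhat_subword yw we.
by move/eqP: sm => sm; exists (Tuple sm).
Qed.

(** * Twisted involutions *)

Section Twisted.
Variables (star : W -> W) (Hstar : star_automorphism S star).
Local Notation I := (twisted_involution star).

Lemma star1 : star 1 = 1.
Proof. by apply: (@mulgI _ (star 1)); rewrite -(star_mul Hstar) !mulg1. Qed.

Lemma len_star w : len S (star w) = len S w.
Proof.
suff h x : (len S (star x) <= len S x)%N.
  by apply/eqP; rewrite eqn_leq h -{1}[w](star_star Hstar) h.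
case: (reduced_word x) => e xe <-; rewrite -(size_map star); apply: len_le_word.
elim: e x xe => [|s e IH] x.
  by case=> _ ->; rewrite big_nil star1; split=> //; rewrite big_nil.
case/is_word_consP => Ss /IH h _; rewrite -(simpleK x Ss) (star_mul Hstar).
by apply: is_word_cons h; exact: star_S Hstar _ Ss.
Qed.

Lemma twisted1 : I 1.
Proof. by rewrite /twisted_involution /= star1 invg1. Qed.

Lemma twistedE w : I w -> star w = w^-1.
Proof. by move=> Iw; rewrite -[LHS]invgK Iw. Qed.

(** The map that sends [x] to [(star x)^-1] preserves length and fixes [w], so it exchanges
    multiplication by [s] on the left with multiplication by [star s] on the right. *)
Lemma twisted_simple_r s w : S s -> I w -> w * star s = (star (s * w))^-1.
Proof.
move=> Ss Iw; rewrite (star_mul Hstar) (twistedE Iw) invgM invgK.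
by rewrite (simple_inv (star_S Hstar Ss)).
Qed.

Lemma twisted_len_r s w : S s -> I w -> len S (w * star s) = len S (s * w).
Proof. by move=> Ss Iw; rewrite twisted_simple_r // len_inv len_star. Qed.

Lemma twisted_comm s w : S s -> I w -> s * w = w * star s -> I (s * w).
Proof.
by move=> Ss Iw sw; rewrite /twisted_involution /= -twisted_simple_r.
Qed.

Lemma twisted_conj s w : S s -> I w -> I (s * w * star s).
Proof.
move=> Ss Iw; rewrite /twisted_involution /= !(star_mul Hstar) (star_star Hstar).
rewrite (twistedE Iw) !invgM !invgK (simple_inv Ss).
by rewrite (simple_inv (star_S Hstar Ss)) mulgA.
Qed.

Lemma twisted_len_conj s w : S s -> I w -> s * w <> w * star s ->
  len S (s * w) = (len S w).+1 -> len S (s * w * star s) = (len S w).+2.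
Proof.
move=> Ss Iw nsw lsw; have Ss' := star_S Hstar Ss.
by case: (len_double Ss Ss' lsw) => //; rewrite twisted_len_r.
Qed.

Lemma twisted_len_conj_le s w : S s -> I w ->
  (len S (s * w * star s) <= (len S (s * w)).+1)%N.
Proof.
by move=> Ss Iw; case: (simple_len_r (s * w) (star_S Hstar Ss)); lia.
Qed.

(** The engine of the inductions on length. For a left descent [s] of [w], take [w' = s * w] if
    [s * w = w * star s], and [w' = s * w * star s] otherwise; in the second case [len_double],
    applied to [w * star s], shows that the length drops by 2. *)
Lemma twisted_descent w : I w -> w <> 1 -> exists s w', [/\ S s, I w',
  len S (s * w') = (len S w').+1 &
  (s * w' = w' * star s /\ w = s * w') \/
  [/\ s * w' <> w' * star s, w = s * w' * star s & len S w = (len S w').+2]].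
Proof.
move=> Iw w1; have [s Ss lsw] := left_descent w1; have Ss' := star_S Hstar Ss.
have {}lsw : len S w = (len S (s * w)).+1 by case: (simple_len w Ss) => //; lia.
have [sw|nsw] := pselect (s * w = w * star s).
  exists s, (s * w); rewrite simpleK //; split=> //; first exact: twisted_comm.
  by left; rewrite sw simpleKr.
have lws := twisted_len_r Ss Iw.
have sz : s * (s * w * star s) = w * star s by rewrite -mulgA simpleK.
have lz : len S (w * star s) = (len S (s * w * star s)).+1.
  have [h|] := simple_len (w * star s) Ss; last by rewrite mulgA.
  have : len S (w * star s * star s) = (len S (w * star s)).+1.
    by rewrite simpleKr // lws.
  case/(len_double Ss Ss' h).
    by rewrite simpleKr // => e; case: nsw; rewrite -[RHS](simpleK _ Ss) e.
  by rewrite mulgA simpleKr // lws => /eqP; rewrite -addn2 -{1}[len S _]addn0 eqn_add2l.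
exists s, (s * w * star s); rewrite sz lz simpleKr //; split=> //.
  exact: twisted_conj.
by right; split=> [e||]; [apply: nsw|rewrite simpleKr|rewrite lsw -lws lz].
Qed.
End Twisted.
End CoxeterGroup.

(** * The bar operator on M *)

Section Transcendence.
Local Open Scope ring_scope.

Lemma zeval_vQ p : zeval vQ p = tofrac p.
Proof.
elim/poly_ind: p => [|p c IH].
  by rewrite rmorph0 /zeval rmorph0 horner0.
rewrite /zeval rmorphD rmorphM /= map_polyX map_polyC hornerMXaddC.
rewrite -/(zeval vQ p) IH rmorphD rmorphM /=; congr (_ + _).
by rewrite -{2}[c]intz !rmorph_int.
Qed.

Lemma vQ_transcendental p : zeval vQ p = 0 -> p = 0.
Proof. by rewrite zeval_vQ => /eqP; rewrite tofrac_eq0 => /eqP. Qed.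

Lemma vQ2_transcendental p : zeval (vQ ^+ 2) p = 0 -> p = 0.
Proof.
have -> : zeval (vQ ^+ 2) p = zeval vQ (p \Po 'X^2).
  by rewrite /zeval map_comp_poly map_polyXn horner_comp hornerXn.
move=> /vQ_transcendental h; apply/polyP => i; rewrite coef0.
have := congr1 (fun q : {poly int} => q`_(2 * i)) h.
by rewrite coef0 coef_comp_poly_Xn // dvdn_mulr // mulKn.
Qed.
Lemma lc_bounded (F : fieldType) (t : F)
    (t_tr : forall p, zeval t p = 0 -> p = 0) (x : laurent t) :
  exists N : nat, forall n : int, (N <= absz n)%N -> lc t_tr n x = 0.
Proof.
have [p [k e]] := laurent_reprP t_tr x; exists (size p + k).+1%N => n nN.
rewrite (lcE t_tr e); case en : (n + k%:Z) => [m|//] /=.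
by rewrite nth_default //; move: (size p) nN en => q; lia.
Qed.

(* The coefficient form of division by 1 + u. *)
Lemma alternating_support (f : int -> int) (A B : int) (N : nat) :
  (forall n : int, (N <= absz n)%N -> f n = 0) ->
  (forall n : int, f (n - 1) + f n != 0 -> A <= n <= B) ->
  forall n : int, f n != 0 -> A <= n < B.
Proof.
move=> fN fAB.
(* Outside the range [f] only changes sign from one integer to the next, so a nonzero value there
   would persist to infinity, against the bound [N]. *)
have up (n : int) : B < n -> f (n - 1) = - f n.
  move=> Bn; apply/eqP; rewrite -addr_eq0; apply: contraT => /fAB; lia.
have dn (n : int) : n < A -> f n = - f (n - 1).
  move=> nA; apply/eqP; rewrite -addr_eq0 addrC; apply: contraT => /fAB; lia.
have upk (n : int) (k : nat) : B <= n -> f n != 0 -> f (n + k%:Z) != 0.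
  move=> Bn fn; elim: k => [|k]; first by rewrite addr0.
  have -> : n + k%:Z = n + k.+1%:Z - 1 by lia.
  by rewrite up ?oppr_eq0 //; lia.
have dnk (n : int) (k : nat) : n < A -> f n != 0 -> f (n - k%:Z) != 0.
  move=> Bn fn; elim: k => [|k]; first by rewrite subr0.
  have -> : n - k.+1%:Z = n - k%:Z - 1 by lia.
  by rewrite dn ?oppr_eq0 //; lia.
move=> n fn; rewrite leNgt [n < B]ltNge; apply/andP; split; apply/negP => h.
  have := dnk n (N + absz n)%N h fn; rewrite fN ?eqxx //; lia.
have := upk n (N + absz n)%N h fn; rewrite fN ?eqxx //; lia.
Qed.
End Transcendence.

(** * Support of the bar operator, and its involutivity *)

Section InvolutionModule.
Local Open Scope ring_scope.
Variables (W : groupType) (S : set W) (cox : coxeter_system S).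
Variables (star : W -> W) (Hstar : star_automorphism S star).
Variables (H : unitAlgType Au) (T : W -> H) (HH : hecke_algebra S T).
Variables (barH : {rmorphism H -> H}) (HbarH : hecke_bar T barH).
Variables (M : lmodType Au) (a : W -> M) (act : H -> M -> M).
Variables (HM : involution_module S star T a act).
Variables (barM : {additive M -> M}) (HbarM : involution_bar barH a act barM).
Local Notation I := (twisted_involution star).
Local Notation "x <=B y" := (bruhat_le S x y) (at level 70).
Local Notation l w := (len S w).
Local Notation cm := (cf vQ2_transcendental (im_basis HM)).
Implicit Types (w x y z s : W) (m : M).

Lemma actB h m m' : act h (m - m') = act h m - act h m'.
Proof.
by have := im_linr HM h (-1) m' m; rewrite !scaleN1r addrC => ->; rewrite addrC.
Qed.

Lemma act0 h : act h 0 = 0.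
Proof. by have := actB h 0 0; rewrite !subrr. Qed.

Lemma actZ h c m : act h (c *: m) = c *: act h m.
Proof. by have := im_linr HM h c m 0; rewrite act0 !addr0. Qed.

Lemma act0l m : act 0 m = 0.
Proof.
have := im_linl HM m (-1) 0 0; rewrite scaleN1r oppr0 addr0 => ->.
by rewrite scaleN1r addNr.
Qed.

Lemma actDl h h' m : act (h + h') m = act h m + act h' m.
Proof. by have := im_linl HM m 1 h h'; rewrite !scale1r. Qed.

Lemma actZl c h m : act (c *: h) m = c *: act h m.
Proof. by have := im_linl HM m c h 0; rewrite act0l !addr0. Qed.

Lemma act_scalar c m : act (c%:A) m = c *: m.
Proof. by rewrite actZl (im_act1 HM). Qed.

Lemma uXD k n : u ^ (k + n) = u ^ k * u ^ n.
Proof. exact: exprzDr u_unit k n. Qed.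

Lemma T_inv s : S s -> (T s)^-1 = u ^ (- 2) *: (T s + (1 - u ^+ 2)%:A).
Proof.
move=> Ss; have quad := hecke_quad HH Ss.
have tt : T s * T s + (1 - u ^+ 2) *: T s = (u ^+ 2)%:A.
  apply/eqP; rewrite -subr_eq0 -quad; apply/eqP.
  rewrite mulrDl mul1r mulrBr mulr_algr scalerBl scale1r !addrA.
  by congr (_ + _); rewrite addrAC.
have u2 : u ^ (- 2) * u ^+ 2 = 1 by rewrite -[u ^+ 2]/(u ^ 2) -uXD addNr.
have eT : T s * (u ^ (- 2) *: (T s + (1 - u ^+ 2)%:A)) = 1.
  by rewrite -scalerAr mulrDr mulr_algr tt scalerA u2 scale1r.
have Te : (u ^ (- 2) *: (T s + (1 - u ^+ 2)%:A)) * T s = 1.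
  by rewrite -scalerAl mulrDl mulr_algl tt scalerA u2 scale1r.
have Tu : T s \is a GRing.unit by apply/unitrP; eexists; split; [exact: Te|].
by apply: (mulrI Tu); rewrite mulrV.
Qed.

Lemma actTV s k m : S s -> act (T s)^-1 (u ^ k *: m) =
  u ^ (k - 2) *: (act (T s) m + (1 - u ^+ 2) *: m).
Proof.
move=> Ss; rewrite T_inv // actZl actDl act_scalar actZ scalerA.
by rewrite [_ * u ^ k]mulrC -scalerA -scalerDr scalerA -uXD [- 2 + k]addrC.
Qed.

Lemma barM_actT s m : S s -> barM (act (T s) m) = act (T s)^-1 (barM m).
Proof.
move=> Ss; rewrite (ib_semi HbarM); congr (act _ _).
by have := hecke_bar_T HbarH 0 s; rewrite oppr0 !expr0z !scale1r (simple_inv cox Ss).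
Qed.

Lemma barM_uX n m : barM (u ^ n *: m) = u ^ (- n) *: barM m.
Proof.
rewrite -[in LHS]act_scalar (ib_semi HbarM) -(hecke_one HH) (hecke_bar_T HbarH).
by rewrite invg1 (hecke_one HH) invr1 act_scalar.
Qed.

Local Notation supp := (cf_supp vQ2_transcendental (im_basis HM)).
Local Notation cm_monom := (cf_monom vQ2_transcendental (im_basis HM)).

Lemma simple_lt s y : S s -> l (s * y)%g = (l y).+1 -> bruhat_lt S y (s * y)%g.
Proof.
move=> Ss ly; split; first by apply: bruhat_simple => //; rewrite ly.
by move=> e; move: ly; rewrite -e => /n_Sn.
Qed.

Lemma simple_gt s y : S s -> l y = (l (s * y)%g).+1 -> bruhat_lt S (s * y)%g y.
Proof.
move=> Ss ly; rewrite -{2}(simpleK cox y Ss); apply: simple_lt => //.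
by rewrite (simpleK cox).
Qed.

Section Actions.
Variables (s y : W) (k : int).
Hypotheses (Ss : S s) (Iy : I y).

(** A pair of rewriting rules that expresses every power through [u ^ (k - 2)], leaving polynomial
    identities in [u] to [ring]. The next four formulas are expanded into monomials so that supports
    can be read off term by term. *)
Lemma uX2 : (u ^ (k - 1) = u ^ (k - 2) * u) * (u ^ k = u ^ (k - 2) * u ^+ 2).
Proof.
split; last by rewrite -[u ^+ 2]/(u ^ 2) -uXD subrK.
by rewrite -{3}[u]expr1z -uXD; congr (_ ^ _); lia.
Qed.

Lemma actTV_comm_up : (s * y = y * star s)%g -> l (s * y)%g = (l y).+1 ->
  act (T s)^-1 (u ^ k *: a y) = u ^ (k - 1) *: a y + u ^ (k - 2) *: a y
    - u ^ k *: a y + (u ^ (k - 1) *: a (s * y)%g + u ^ (k - 2) *: a (s * y)%g).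
Proof.
move=> sy /(simple_lt Ss) lt; rewrite actTV // (im_comm_up HM) // !uX2.
rewrite -!(scalerDl, scalerBl) addrAC -scalerDl scalerDr !scalerA.
by congr (_ *: _ + _ *: _); ring.
Qed.

Lemma actTV_comm_down : (s * y = y * star s)%g -> l y = (l (s * y)%g).+1 ->
  act (T s)^-1 (u ^ k *: a y) = - (u ^ (k - 1) *: a y)
    + (u ^ k *: a (s * y)%g - u ^ (k - 1) *: a (s * y)%g).
Proof.
move=> sy /(simple_gt Ss) lt; rewrite actTV // (im_comm_down HM) // !uX2.
rewrite -!(scalerDl, scalerBl) addrAC -scalerDl scalerDr !scalerA -scaleNr.
by congr (_ *: _ + _ *: _); ring.
Qed.

Lemma actTV_conj_up : (s * y <> y * star s)%g -> l (s * y)%g = (l y).+1 ->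
  act (T s)^-1 (u ^ k *: a y) =
    u ^ (k - 2) *: a (s * y * star s)%g + (u ^ (k - 2) *: a y - u ^ k *: a y).
Proof.
move=> sy /(simple_lt Ss) lt; rewrite actTV // (im_up HM) // !uX2.
rewrite -!(scalerDl, scalerBl) scalerDr !scalerA.
by congr (_ *: _ + _ *: _); ring.
Qed.

Lemma actTV_conj_down : (s * y <> y * star s)%g -> l y = (l (s * y)%g).+1 ->
  act (T s)^-1 (u ^ k *: a y) = u ^ k *: a (s * y * star s)%g.
Proof.
move=> sy /(simple_gt Ss) lt; rewrite actTV // (im_down HM) // !uX2.
rewrite addrAC -scalerDl.
have -> : (u ^+ 2 - 1 + (1 - u ^+ 2)) = 0 :> Au by ring.
by rewrite scale0r add0r scalerA.
Qed.

End Actions.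

Definition bar_range w y (n : int) := y <=B w /\ - (l w)%:Z <= n <= - (l y)%:Z.

(** * One step of the induction on length, from w' to w *)

Section Step.
Variables (s w' w : W).
Hypotheses (Ss : S s) (Iw' : I w') (lsw' : l (s * w')%g = (l w').+1).
Hypothesis step : (s * w' = w' * star s /\ w = s * w')%g \/
  [/\ (s * w' <> w' * star s)%g, w = (s * w' * star s)%g & l w = (l w').+2].

Lemma step_len : (l w' < l w)%N.
Proof. by case: step => [[_ ->]|[_ _ ->]]; rewrite ?lsw'. Qed.

Lemma step_le y : y <=B w' ->
  [/\ y <=B w, (s * y)%g <=B w & (s * y * star s)%g <=B w].
Proof.
move=> yw'; have Ss' := star_S Hstar Ss.
have lt : (l w' < l (s * w')%g)%N by rewrite lsw'.
have w'sw' := bruhat_simple Ss lt; have sysw' := bruhat_lift_up cox Ss lt yw'.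
case: step => [[sw' ->]|[sw' we lw]].
  split=> //; first exact: bruhat_trans w'sw'.
  case: (bruhat_lift_r cox Ss' sysw') => // h.
  by apply: bruhat_trans w'sw'; rewrite {1}sw' (simpleKr cox) in h.
have lt2 : (l (s * w')%g < l (s * w' * star s)%g)%N by rewrite -we lw lsw'.
have sw'w := bruhat_simple_r Ss' lt2; rewrite we; split.
- exact: bruhat_trans (bruhat_trans yw' w'sw') sw'w.
- exact: bruhat_trans sysw' sw'w.
- exact: (bruhat_lift_up_r cox).
Qed.

(** The lowest exponent [- l w' - 2] equals [- l w] in the conjugation case. In the commuting case
    it is one less, an excess that the later division absorbs. At this exponent [a w] can only come
    from [y = w'] and [k = - l w']. *)
Lemma step_monom y (k : int) : I y -> bar_range w' y k ->
  supp (fun z (n : int) => z <=B w /\ - (l w')%:Z - 2 <= n <= - (l z)%:Z)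
       (act (T s)^-1 (u ^ k *: a y)) /\
  cm w (- (l w')%:Z - 2) (act (T s)^-1 (u ^ k *: a y)) =
  cm w' (- (l w')%:Z) (u ^ k *: a y).
Proof.
move=> Iy [yw' /andP[k1 k2]]; have [yw syw sysw] := step_le yw'.
have lw := step_len; have ly := bruhat_len_le yw'.
have yNw : (w == y) = false.
  by apply/eqP => e; move: ly; rewrite -e leqNgt lw.
set N : int := - (l w')%:Z - 2.
have kN1 : (N == k - 1) = false by apply/eqP; lia.
have kN2 : (N == k - 2) = (- (l w')%:Z == k) by apply/eqP/eqP; lia.
have [sy|sy] := pselect (s * y = y * star s)%g; case: (simple_len cox y Ss) => lsy.
- have Isy := twisted_comm cox Hstar Ss Iy sy.
  have wsy : (w == s * y)%g = (w' == y).
    apply/eqP/eqP => [e|e]; case: step => [[sw' we]|[sw' we lw2]].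
    + by apply: (mulgI s); rewrite -we.
    + by exfalso; move: lw2; rewrite e lsy; lia.
    + by rewrite we e.
    + by case: sw'; rewrite e.
  rewrite (actTV_comm_up _ Ss Iy sy lsy); split.
    by apply: cf_suppD; [apply: cf_suppB; [apply: cf_suppD|]|apply: cf_suppD];
      apply: cf_supp_monom => //; split=> //; lia.
  rewrite !(cfD, cfN) !(cm_monom _ _ _ Iy) !(cm_monom _ _ _ Isy).
  rewrite yNw wsy kN1 kN2.
  by rewrite /= andbF subr0 !add0r.
- have Isy := twisted_comm cox Hstar Ss Iy sy.
  have wsy : (w == s * y)%g = false by apply/eqP => e; move: lw; rewrite e; lia.
  have w'y : (w' == y) = false.
    by apply/eqP => e; move: lsw'; rewrite e; lia.
  rewrite (actTV_comm_down _ Ss Iy sy lsy); split.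
    by apply: cf_suppD; [apply: cf_suppN|apply: cf_suppB];
      apply: cf_supp_monom => //; split=> //; lia.
  rewrite !(cfD, cfN) !(cm_monom _ _ _ Iy) !(cm_monom _ _ _ Isy).
  rewrite yNw wsy w'y.
  by rewrite /= !subr0.
- have Isy := twisted_conj cox Hstar Ss Iy.
  have lsys := twisted_len_conj cox Hstar Ss Iy sy lsy.
  have wsy : (w == s * y * star s)%g = (w' == y).
    apply/eqP/eqP => [e|e]; case: step => [[sw' we]|[sw' we lw2]].
    (* Here [w = s * w'] would force [y = w' * star s], longer than [w'], although [y] lies below
       [w']. *)
    + exfalso; move: lsw'; rewrite sw'; have -> : (w' * star s = y)%g.
        rewrite -[RHS](simpleKr cox _ (star_S Hstar Ss)); congr (_ * _)%g.
        by apply: (mulgI s); rewrite mulgA -e we.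
      by lia.
    + by apply: (mulgI s); apply: (mulIg (star s)); rewrite -we.
    + by case: sy; rewrite -e.
    + by rewrite we e.
  rewrite (actTV_conj_up _ Ss Iy sy lsy); split.
    by apply: cf_suppD; last apply: cf_suppB;
      apply: cf_supp_monom => //; split=> //; lia.
  rewrite !(cfD, cfN) !(cm_monom _ _ _ Iy) !(cm_monom _ _ _ Isy).
  rewrite yNw wsy kN2.
  by rewrite /= oppr0 !addr0.
- have Isy := twisted_conj cox Hstar Ss Iy.
  have lsys := twisted_len_conj_le cox Hstar Ss Iy.
  have wsy : (w == s * y * star s)%g = false.
    by apply/eqP => e; move: lw; rewrite e; lia.
  have w'y : (w' == y) = false.
    by apply/eqP => e; move: lsw'; rewrite e; lia.
  rewrite (actTV_conj_down _ Ss Iy sy lsy); split.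
    by apply: cf_supp_monom => //; split=> //; lia.
  by rewrite !(cm_monom _ _ _ Iy) !(cm_monom _ _ _ Isy) wsy w'y.
Qed.

Lemma step_act m : supp (bar_range w') m ->
  supp (fun z (n : int) => z <=B w /\ - (l w')%:Z - 2 <= n <= - (l z)%:Z)
       (act (T s)^-1 m) /\
  cm w (- (l w')%:Z - 2) (act (T s)^-1 m) = cm w' (- (l w')%:Z) m.
Proof.
move=> sm; pose P (x : M) := supp (fun z (n : int) => z <=B w /\
  - (l w')%:Z - 2 <= n <= - (l z)%:Z) (act (T s)^-1 x) /\
  cm w (- (l w')%:Z - 2) (act (T s)^-1 x) = cm w' (- (l w')%:Z) x.
apply: (@cf_ind _ _ vQ2_transcendental _ _ _ _ (im_basis HM) P).
- by rewrite /P act0; split; [exact: cf_supp0|rewrite !cf0].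
- move=> x x' [x1 x2] [y1 y2]; rewrite /P actB; split; first exact: cf_suppB.
  by rewrite !cfD !cfN x2 y2.
- by move=> y n Iy nz; apply: step_monom => //; exact: sm.
Qed.

Lemma step_bar : supp (bar_range w') (barM (a w')) ->
  cm w' (- (l w')%:Z) (barM (a w')) = 1 ->
  supp (bar_range w) (barM (a w)) /\ cm w (- (l w)%:Z) (barM (a w)) = 1.
Proof.
move=> sbar cbar; have [sact cact] := step_act sbar.
case: step => [[sw' we]|[sw' we lw]]; last first.
  have aw : a w = act (T s) (a w').
    by rewrite (im_up HM Ss Iw' sw' (simple_lt Ss lsw')) we.
  rewrite aw (barM_actT _ Ss).
  have -> : - (l w)%:Z = - (l w')%:Z - 2 by rewrite lw; lia.
  rewrite cact; split; last exact: cbar.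
  move=> y n /sact [yw /andP[n1 n2]]; split=> //.
  by rewrite lw; lia.
have lw : l w = (l w').+1 by rewrite we.
(* Bar turns [(u + 1) a_w = T_s a_w' - u a_w'] into an equation for [(u^-1 + 1)] times [barM (a w)];
   this is its coefficient at [u ^ (n - 1) *: a y]. *)
have eq y (n : int) : cm y (n - 1) (barM (a w)) + cm y n (barM (a w)) =
    cm y (n - 1) (act (T s)^-1 (barM (a w'))) - cm y n (barM (a w')).
  have := congr1 barM (im_comm_up HM Ss Iw' sw' (simple_lt Ss lsw')).
  rewrite (barM_actT _ Ss) -we scalerDl scale1r -[u]expr1z !raddfD /= !barM_uX => ->.
  rewrite !cfD !cf_shift opprK subrK.
  by move: (cm y n _) (cm y n _) (cm y (n - 1) _) => A B C; lia.
have fin y : exists N : nat, forall n : int, (N <= absz n)%N ->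
  cm y n (barM (a w)) = 0 by exact: lc_bounded.
have sum_supp y (n : int) : cm y (n - 1) (barM (a w)) + cm y n (barM (a w)) != 0 ->
    y <=B w /\ - (l w)%:Z <= n <= - (l y)%:Z + 1.
  rewrite eq; set m := act _ _.
  have [->|/sact[yw n12] _] := eqVneq (cm y (n - 1) m) 0.
    rewrite add0r oppr_eq0 => /sbar[yw' n12]; split; last by rewrite lw; lia.
    by have [] := step_le yw'.
  by split=> //; rewrite lw; lia.
have sw : supp (bar_range w) (barM (a w)).
  move=> y n nz; have [N NP] := fin y.
  have yw : y <=B w.
    apply: contrapT => nyw.
    (* For [y] not below [w] all sums of consecutive coefficients vanish, so an empty range may be
       taken as the bound. *)
    suff : 1 <= n < 0 by lia.
    apply: (@alternating_support (fun n => cm y n (barM (a w))) _ _ N NP _ n nz).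
    by move=> k /sum_supp[/nyw].
  split; first exact: yw.
  suff : - (l w)%:Z <= n < - (l y)%:Z + 1 by lia.
  apply: (@alternating_support (fun n => cm y n (barM (a w))) _ _ N NP _ n nz).
  by move=> k /sum_supp[].
split; first exact: sw.
(* At [n = - l w] the coefficient at [n - 1] is out of range and [a w] does not occur in
   [barM (a w')], so only the leading coefficient remains. *)
have := eq w (- (l w)%:Z).
have -> : - (l w)%:Z - 1 = - (l w')%:Z - 2 by rewrite lw; lia.
rewrite cact cbar.
have -> : cm w (- (l w')%:Z - 2) (barM (a w)) = 0.
  apply/eqP/negPn/negP => /sw[_]; rewrite lw; lia.
have -> : cm w (- (l w)%:Z) (barM (a w')) = 0.
  apply/eqP/negPn/negP => /sbar[/bruhat_len_le]; rewrite lw; lia.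
by rewrite add0r subr0.
Qed.
End Step.

Lemma bar_basis1 :
  supp (bar_range 1%g) (barM (a 1%g)) /\ cm 1%g (- (l 1%g)%:Z) (barM (a 1%g)) = 1.
Proof.
have I1 := twisted1 Hstar; have e : a 1%g = u ^ 0 *: a 1%g by rewrite expr0z scale1r.
rewrite (ib_one HbarM) e (cm_monom _ _ _ I1) (len1 cox)
  !eqxx; split; last by [].
by apply: (cf_supp_monom I1); split; [exact: bruhat_refl|rewrite (len1 cox)].
Qed.

Lemma bar_basis w : I w ->
  supp (bar_range w) (barM (a w)) /\ cm w (- (l w)%:Z) (barM (a w)) = 1.
Proof.
elim: {w}(l w) {-2}w (leqnn (l w)) => [|n IH] w lw Iw.
all: have [->|w1] := pselect (w = 1%g); first exact: bar_basis1.
  by case: w1; apply: (len_eq0 cox); apply/eqP; rewrite -leqn0.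
have [s [w' [Ss Iw' lsw' step]]] := twisted_descent cox Hstar Iw w1.
have lt := step_len lsw' step; case: (IH w' _ Iw'); first by lia.
exact: (step_bar Ss).
Qed.

Lemma barM_act_barM h m : barM (barM (act h m)) = act h (barM (barM m)).
Proof. by rewrite !(ib_semi HbarM) (hecke_bar_invol HbarH). Qed.

(** If [(u + 1) *: d = 0], consecutive coefficients of [d] are opposite, and [alternating_support]
    with an empty range leaves none. *)
Lemma scale_u1_inj : injective (fun m : M => (u + 1) *: m).
Proof.
move=> x y /= /eqP; rewrite -subr_eq0 -scalerBr => /eqP xy.
apply/eqP; rewrite -subr_eq0; apply/eqP; set d := x - y in xy *.
apply: (cf_inj (t_tr := vQ2_transcendental) (Hb := im_basis HM)) => z n.
rewrite cf0; apply/eqP/negPn/negP => nz.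
have [N NP] := lc_bounded vQ2_transcendental (bcoord (im_basis HM) z d).
suff : 1 <= n < 0 by lia.
apply: (@alternating_support (fun n => cm z n d) _ _ N NP _ n nz) => k.
suff -> : cm z (k - 1) d + cm z k d = 0 by rewrite eqxx.
have := congr1 (cm z k) xy.
by rewrite (cf0 _ _ z k) scalerDl scale1r cfD -[X in X *: d]expr1z cf_shift.
Qed.

(** Applying bar twice commutes with the action of [H], so it fixes whatever [T s] produces from the
    shorter [a w']; in the commuting case [u + 1] is then cancelled. *)
Lemma barM_basis_invol w : I w -> barM (barM (a w)) = a w.
Proof.
elim: {w}(l w) {-2}w (leqnn (l w)) => [|n IH] w lw Iw.
all: have [w1|w1] := pselect (w = 1%g).
1,3: by rewrite w1 !(ib_one HbarM).
  by case: w1; apply: (len_eq0 cox); apply/eqP; rewrite -leqn0.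
have [s [w' [Ss Iw' lsw' step]]] := twisted_descent cox Hstar Iw w1.
have lt := step_len lsw' step; have {}IH : barM (barM (a w')) = a w'.
  by apply: IH => //; lia.
case: step => [[sw' we]|[sw' we _]]; last first.
  by rewrite we -(im_up HM Ss Iw' sw' (simple_lt Ss lsw')) barM_act_barM IH.
have := im_comm_up HM Ss Iw' sw' (simple_lt Ss lsw'); rewrite -we => e.
have := congr1 (fun m => barM (barM m)) e.
rewrite barM_act_barM IH e !raddfD /= scalerDl scale1r !raddfD /=.
rewrite -{3}[u]expr1z !barM_uX opprK expr1z IH => /addrI h.
apply: scale_u1_inj; rewrite /= scalerDl scale1r [RHS]scalerDl scale1r h.
by rewrite -[u]expr1z !barM_uX opprK.
Qed.

Lemma barM_invol m : barM (barM m) = m.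
Proof.
apply: (@cf_ind _ _ vQ2_transcendental _ _ _ _ (im_basis HM)
  (fun m => barM (barM m) = m)).
- by rewrite !raddf0.
- by move=> x y xx yy; rewrite !raddfB /= xx yy.
- move=> w n Iw _; rewrite -[lgen _]/u !barM_uX opprK barM_basis_invol //.
Qed.
End InvolutionModule.

(** * The canonical basis *)

Section Span.
Local Open Scope ring_scope.
Variables (R : nzRingType) (V : lmodType R) (T : Type) (j : T -> V).

Definition span_pred : {pred V} :=
  fun x => `[< exists s : seq (R * T), x = \sum_(p <- s) p.1 *: j p.2 >].

Lemma span_submod_closed : submod_closed span_pred.
Proof.
split=> [|k x y /asboolP[s ->] /asboolP[r ->]]; apply/asboolP.
  by exists [::]; rewrite big_nil.
exists ([seq (k * p.1, p.2) | p <- s] ++ r).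
rewrite big_cat big_map scaler_sumr; congr (_ + _).
by apply: eq_bigr => p _; rewrite scalerA.
Qed.
HB.instance Definition _ := GRing.isSubmodClosed.Build R V span_pred span_submod_closed.

Record spanned := Spanned { spanned_val :> V; _ : spanned_val \in span_pred }.
HB.instance Definition _ := [isSub for spanned_val].
HB.instance Definition _ := [Choice of spanned by <:].
HB.instance Definition _ := [SubChoice_isSubLmodule of spanned by <:].

Lemma span_gen m : j m \in span_pred.
Proof. by apply/asboolP; exists [:: (1, m)]; rewrite big_seq1 scale1r. Qed.
End Span.

(* Surjectivity part of the universal property: the two maps compared are the
   identity and the retraction onto the submodule spanned by the image of j. *)
Lemma base_change_span (R R' : comNzRingType) (phi : {rmorphism R -> R'})
    (M : lmodType R) (M' : lmodType R') (j : M -> M') (x : M') :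
  is_base_change phi j ->
  exists s : seq (R' * M), x = (\sum_(p <- s) p.1 *: j p.2)%R.
Proof.
move=> [jlin univ].
pose f m : spanned j := Spanned (span_gen j m).
have flin c y z : (f (c *: y + z) = phi c *: f y + f z)%R.
  by apply: val_inj; rewrite /= jlin.
have [[g gf] _] := univ _ f flin; have [_ uniq] := univ _ j jlin.
have <- : val (g x) = x.
  by apply: (uniq (val \o g : {linear M' -> M'}) idfun) => m /=; rewrite gf.
by have /asboolP := valP (g x).
Qed.

(** * The normalised basis and bar after base change *)

Section FinalBasis.
Local Open Scope ring_scope.
Variables (W : groupType) (S : set W) (cox : coxeter_system S).
Variables (star : W -> W) (Hstar : star_automorphism S star).
Variables (H : unitAlgType Au) (T : W -> H) (HH : hecke_algebra S T).
Variables (barH : {rmorphism H -> H}) (HbarH : hecke_bar T barH).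
Variables (M : lmodType Au) (a : W -> M) (act : H -> M -> M).
Variables (HM : involution_module S star T a act).
Variables (barM : {additive M -> M}) (HbarM : involution_bar barH a act barM).
Variables (M' : lmodType Av) (j : M -> M') (HM' : is_base_change Au_Av j).
Variables (barM' : {additive M' -> M'}) (HbarM' : extends_bar barM j barM').
Local Notation I := (twisted_involution star).
Local Notation "x <=B y" := (bruhat_le S x y) (at level 70).
Local Notation l w := (len S w).
Local Notation cm := (cf vQ2_transcendental (im_basis HM)).
Local Notation cm_monom := (cf_monom vQ2_transcendental (im_basis HM)).
Implicit Types (w : W) (m : M) (x : M').

Lemma vX_unit n : v ^ n \is a GRing.unit.
Proof. exact: (lgenXz_unit vQ_transcendental). Qed.

Lemma vXD n k : v ^ (n + k) = v ^ n * v ^ k.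
Proof. exact: exprzDr v_unit n k. Qed.

Lemma jB m m' : j (m - m') = j m - j m'.
Proof.
have := HM'.1 (-1) m' m; rewrite rmorphN1 !scaleN1r addrC => ->.
by rewrite addrC.
Qed.

Lemma j0 : j 0 = 0.
Proof. by have := jB 0 0; rewrite !subrr. Qed.

Lemma jZ c m : j (c *: m) = Au_Av c *: j m.
Proof. by have := HM'.1 c m 0; rewrite j0 !addr0. Qed.

Lemma jD m m' : j (m + m') = j m + j m'.
Proof. by have := HM'.1 1 m m'; rewrite rmorph1 !scale1r. Qed.

Definition nbasis w : M' := v ^ (- (l w)%:Z) *: j (a w).

Lemma j_basis w : j (a w) = v ^ (l w) *: nbasis w.
Proof. by rewrite /nbasis scalerA -vXD subrr expr0z scale1r. Qed.

Lemma Au_Av_uX k : Au_Av (u ^ k) = v ^ (2 * k).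
Proof. by rewrite (rmorphXz _ k u_unit) Au_Av_u exprnP exprz_exp. Qed.

Lemma j_monom w k : j (u ^ k *: a w) = v ^ (2 * k + (l w)%:Z) *: nbasis w.
Proof.
by rewrite jZ j_basis scalerA Au_Av_uX -vXD.
Qed.

(** Spanning comes from [base_change_span]. For independence, the universal property extends each
    coordinate function of [M] to a linear form on [M']. *)
Lemma is_basis_nbasis : is_basis I nbasis.
Proof.
apply: is_basisI => [x|c s Is eq0 i si].
  have [r ->] := base_change_span x HM'; elim: r => [|[k m] r IH].
    by rewrite big_nil; exact: in_span0.
  rewrite big_cons; apply: in_spanZD IH => /=.
  have [q [Iq _ ->]] := bcoord_expand (im_basis HM) m.
  rewrite big_seq; elim/big_rec: _ => [|z y qz yP].
    by rewrite j0; exact: in_span0.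
  rewrite jD jZ j_basis scalerA; apply: in_spanZD yP.
  by apply: in_span_basis; exact: Iq.
pose f m : Av^o := Au_Av (bcoord (im_basis HM) i m).
have flin k m m' : f (k *: m + m') = Au_Av k *: f m + f m'.
  by rewrite /f raddfD /= bcoordZ rmorphD rmorphM.
have [[g gE] _] := HM'.2 _ f flin.
have gb y : I y -> g (nbasis y) = v ^ (- (l y)%:Z) * (i == y)%:R.
  by move=> Iy; rewrite linearZ /= gE /f bcoord_basis // rmorph_nat.
have := congr1 g eq0; rewrite raddf0 raddf_sum /= (big_fsetD1 i) //= big_seq big1 => [|y].
  rewrite linearZ addr0 /= gb; last exact: Is.
  rewrite eqxx mulr1 => h; apply: (mulIr (vX_unit (- (l i)%:Z))).
  by rewrite mul0r.
rewrite !inE => /andP[yi sy]; rewrite linearZ /= gb; last exact: Is.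
by rewrite eq_sym (negbTE yi) mulr0 scaler0.
Qed.

Local Notation cv := (cf vQ_transcendental is_basis_nbasis).
Local Notation supp := (cf_supp vQ_transcendental is_basis_nbasis).
Local Notation cv_monom := (cf_monom vQ_transcendental is_basis_nbasis).

(** [extends_bar] gives this on the elements [v ^ k *: j m] only; they generate [M'] additively. *)
Lemma barM'_vX n (x : M') : barM' (v ^ n *: x) = v ^ (- n) *: barM' x.
Proof.
pose P (x : M') := forall n, barM' (v ^ n *: x) = v ^ (- n) *: barM' x.
suff : P x by apply.
apply: (@cf_ind _ _ vQ_transcendental _ _ _ _ is_basis_nbasis P) => {n}.
- by move=> n; rewrite scaler0 !raddf0.
- by move=> y y' Py Py' n; rewrite scalerBr !(raddfB barM') Py Py' scalerBr.
- move=> w k Iw _ n; rewrite /nbasis -[lgen _]/v !scalerA -!vXD.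
  by rewrite !HbarM' scalerA -vXD !opprD addrA.
Qed.

Lemma barM'_nbasis w : barM' (nbasis w) = v ^ (l w) *: j (barM (a w)).
Proof. by rewrite HbarM' opprK. Qed.

Lemma barM'_invol (x : M') : barM' (barM' x) = x.
Proof.
apply: (@cf_ind _ _ vQ_transcendental _ _ _ _ is_basis_nbasis
  (fun x => barM' (barM' x) = x)).
- by rewrite !raddf0.
- by move=> y y' yy yy'; rewrite !raddfB /= yy yy'.
- move=> w n Iw _; rewrite -[lgen _]/v (barM'_vX n) (barM'_vX (- n)) opprK.
  rewrite barM'_nbasis (barM'_vX (l w)).
  rewrite -[j _]scale1r -(expr0z v) HbarM' oppr0 expr0z scale1r.
  by rewrite (barM_invol cox Hstar HH HbarH HM HbarM).
Qed.

(* The exponents occurring in v ^ (l y - l w) * P (v ^ 2) and its bar, for a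
   polynomial P of degree at most l w - l y. *)
Definition nrange w y (n : int) := y <=B w /\
  exists2 i : nat, (i <= l w - l y)%N & n = 2 * i%:Z + (l y)%:Z - (l w)%:Z.

Lemma nrange_trans w y z (n k : int) :
  nrange w y k -> nrange y z n -> nrange w z (n + k).
Proof.
move=> [yw [i il ->]] [zy [i' il' ->]]; split; first exact: bruhat_trans yw.
have := bruhat_len_le yw; have := bruhat_len_le zy => l1 l2.
by exists (i' + i)%N; lia.
Qed.

Lemma nrange_opp w y (n : int) : nrange w y n -> nrange w y (- n).
Proof.
move=> [yw [i il ->]]; split; first exact: yw.
by have l1 := bruhat_len_le yw; exists (l w - l y - i)%N; lia.
Qed.

Lemma nrange_refl w : nrange w w 0.
Proof. by split; [exact: bruhat_refl|exists 0%N => //; lia]. Qed.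

Lemma barM'_nbasis_supp w : I w -> supp (nrange w) (barM' (nbasis w)) /\
  forall n, cv w n (barM' (nbasis w)) = (n == 0)%:R.
Proof.
move=> Iw; have [sb cb] := bar_basis cox Hstar HH HbarH HM HbarM Iw.
rewrite barM'_nbasis; set m := barM (a w) in sb cb *.
have [s1 s2] : supp (nrange w) (v ^ (l w) *: j m) /\
    forall n, cv w n (v ^ (l w) *: j m) = (n == 0)%:R * cm w (- (l w)%:Z) m.
  pose P m := supp (nrange w) (v ^ (l w) *: j m) /\
    forall n, cv w n (v ^ (l w) *: j m) = (n == 0)%:R * cm w (- (l w)%:Z) m.
  apply: (@cf_ind _ _ vQ2_transcendental _ _ _ _ (im_basis HM) P).
  - rewrite /P j0 scaler0; split; first exact: cf_supp0.
    by move=> n; rewrite !cf0 mulr0.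
  - move=> x y [x1 x2] [y1 y2]; rewrite /P jB scalerBr.
    split; first exact: (cf_suppB x1 y1).
    by move=> n; rewrite !cfD !cfN x2 y2 mulrBr.
  - move=> y k Iy nz; have [yw /andP[k1 k2]] := sb y k nz.
    rewrite /P -[lgen _]/u j_monom scalerA -vXD; have l1 := bruhat_len_le yw.
    split.
      apply: (cf_supp_monom Iy); split; first exact: yw.
      (* The exponent is [l w + 2k + l y = 2 (k + l w) + l y - l w], and [k + l w] is
         nonnegative. *)
      by exists (absz (k + (l w)%:Z)); lia.
    move=> n; rewrite (cv_monom _ _ _ Iy).
    rewrite (cm_monom _ _ _ Iy).
    case: (w =P y) => [wy|_]; last by rewrite mulr0.
    have -> : k = - (l w)%:Z by rewrite -wy in k2; lia.
    by rewrite eqxx mulr1 -wy /=; congr (_ == _)%:R; lia.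
by split; [exact: s1|move=> n; rewrite s2 cb mulr1].
Qed.

(** By unitriangularity the new terms of [barM' (nbasis z)] are shorter than [z], so in the top
    length bar merely replaces [v] by its inverse. *)
Lemma barM'_top N x : supp (fun y _ => l y <= N)%N x ->
  supp (fun y _ => l y <= N)%N (barM' x) /\
  forall y (n : int), l y = N -> cv y n (barM' x) = cv y (- n) x.
Proof.
move=> sx; pose P x := supp (fun y _ => l y <= N)%N (barM' x) /\
  forall y (n : int), l y = N -> cv y n (barM' x) = cv y (- n) x.
apply: (@cf_ind _ _ vQ_transcendental _ _ _ _ is_basis_nbasis P).
- rewrite /P (raddf0 barM'); split; first exact: cf_supp0.
  by move=> y n _; rewrite !cf0.
- move=> x1 x2 [s1 e1] [s2 e2]; rewrite /P (raddfB barM').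
  split; first exact: (cf_suppB s1 s2).
  by move=> y n ly; rewrite !cfD !cfN (e1 y n ly) (e2 y n ly).
- move=> z k Iz nz; have lz := sx z k nz; have [sz ez] := barM'_nbasis_supp Iz.
  rewrite /P -[lgen _]/v barM'_vX; split.
    move=> y n; rewrite cf_shift => /sz[/bruhat_len_le yz _].
    exact: leq_trans lz.
  move=> y n ly; rewrite cf_shift (cv_monom _ _ _ Iz).
  case: (y =P z) => [->|yz].
    by rewrite ez opprK /=; congr (_ : bool)%:R; apply/eqP/eqP; lia.
  apply/eqP/negPn/negP => /sz[/bruhat_len[//|]].
  by rewrite ly ltnNge lz.
Qed.

(** The form of [is_A] used for existence: [nrange] records the parity and bounds that make
    coefficients polynomials in [u], and [n < 0] is the degree condition. *)
Definition selfdual w x := [/\ barM' x = x, supp (nrange w) x,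
  forall y (n : int), cv y n x != 0 -> y <> w -> n < 0 &
  forall n : int, cv w n x = (n == 0)%:R].

(** * Existence *)

Section Existence.
Variables (w : W) (A : W -> M').
Hypothesis AP : forall y, I y -> (l y < l w)%N -> selfdual y (A y).

(** In the top length the coefficients of [x] are odd under [v -> v^-1]. Each negative monomial
    [v ^ k *: nbasis z] there is taken into [p] as [v ^ k *: A z], whose bar is [v ^ (- k) *: A z];
    what remains is shorter. *)
Lemma antiselfdual_split N x : (N <= l w)%N ->
  supp (fun y n => nrange w y n /\ (l y < N)%N) x -> barM' x = - x ->
  exists2 p, supp (fun y n => [/\ nrange w y n, (l y < N)%N & n < 0]) p &
    p - barM' p = x.
Proof.
elim: N x => [|N IH] x Nw sx bx.
  exists 0; first exact: cf_supp0.
  rewrite (raddf0 barM') subr0.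
  apply: (cf_inj (t_tr := vQ_transcendental) (Hb := is_basis_nbasis)) => y n.
  by rewrite cf0; apply/esym/eqP/negPn/negP => /sx[].
pose P x := exists p, [/\
  supp (fun y n => [/\ nrange w y n, (l y < N.+1)%N & n < 0]) p,
  supp (nrange w) (barM' p) &
  forall y (n : int), l y = N -> cv y n p = if n < 0 then cv y n x else 0].
have [p [sp sbp cp]] : P x.
  apply: (@cf_ind _ _ vQ_transcendental _ _ _ _ is_basis_nbasis P).
  - exists 0; rewrite (raddf0 barM'); split; [exact: cf_supp0|exact: cf_supp0|].
    by move=> y n _; rewrite !cf0 if_same.
  - move=> x1 x2 [p1 [s1 b1 c1]] [p2 [s2 b2 c2]]; exists (p1 - p2).
    rewrite (raddfB barM'); split; [exact: (cf_suppB s1 s2)|exact: (cf_suppB b1 b2)|].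
    move=> y n ly; rewrite !cfD !cfN (c1 y n ly) (c2 y n ly).
    by case: (n < 0); [|exact: subr0].
  move=> z k Iz nz; have [zk lz] := sx z k nz; rewrite -[lgen _]/v.
  have [/andP[/eqP lzN k0]|nlow] := boolP ((l z == N) && (k < 0)); last first.
    exists 0; rewrite (raddf0 barM'); split; [exact: cf_supp0|exact: cf_supp0|].
    move=> y n ly; rewrite cf0 (cv_monom _ _ _ Iz).
    case: ifP => // n0; case: (y =P z) => [yz|//]; case: (n =P k) => [nk|//].
    by move: nlow; rewrite -yz ly eqxx -nk n0.
  have [bA sA nA tA] := AP Iz (leq_ltn_trans (eq_leq lzN) Nw).
  exists (v ^ k *: A z); rewrite barM'_vX bA; split=> y n.
  - rewrite cf_shift => nz'; have := sA y _ nz' => r.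
    have yz := r.1; split.
    + by rewrite -(subrK k n); exact: nrange_trans r.
    + by rewrite ltnS -lzN; exact: bruhat_len_le.
    + have [yez|/eqP yNz] := eqVneq y z; last by have := nA y _ nz' yNz; lia.
      by move: nz'; rewrite yez tA; case: (n - k =P 0) => //; lia.
  - rewrite cf_shift => nz'; have := sA y _ nz' => r.
    by rewrite -(subrK (- k) n); apply: nrange_trans r; exact: nrange_opp.
  - move=> ly; rewrite cf_shift (cv_monom _ _ _ Iz).
    case: (y =P z) => [->|yz] /=.
      rewrite tA subr_eq0; case: (n =P k) => [->|_]; first by rewrite k0.
      by rewrite if_same.
    rewrite if_same; apply/eqP/negPn/negP => /sA[/bruhat_len[//|]].
    by rewrite ly lzN ltnn.
have [sbp' cbp] := barM'_top (N := N) (x := p)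
  (fun y n nz => let: And3 _ h _ := sp y n nz in h).
have [||p' sp' ep'] := IH (x - (p - barM' p)) (ltnW Nw).
- move=> y n nz.
  have [r lyN] : nrange w y n /\ (l y <= N)%N.
    move: nz; rewrite !(cfD, cfN); have [->|/sx[] //] := eqVneq (cv y n x) 0.
    have [->|/sp[] //] := eqVneq (cv y n p) 0.
    by rewrite !sub0r opprK => nz; split; [exact: sbp|exact: (sbp' y n)].
  split=> //; rewrite ltn_neqAle lyN andbT; apply/negP => /eqP ly.
  move: nz; rewrite !(cfD, cfN) cbp // !cp //.
  have [_ cbx] := barM'_top (N := N) (x := x) (fun y n nz => (sx y n nz).2).
  have := congr1 (cv y n) bx; rewrite cfN cbx //.
  (* At [n = 0] the coefficient is its own opposite, hence 0. *)
  have : n = 0 -> cv y (- n) x = cv y n x by move=> ->; rewrite oppr0.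
  move: (cv y (- n) x) (cv y n x) => B C h0 h1 /negP; apply; apply/eqP.
  by case: ifP; case: ifP; lia.
- by rewrite !(raddfB barM') bx barM'_invol !opprB addrC.
exists (p' + p).
  apply: cf_suppD => y n nz; last exact: sp.
  by have [r lyN n0] := sp' y n nz; split=> //; exact: ltnW.
by rewrite (raddfD barM') opprD addrACA ep' subrK.
Qed.

(** With [b = nbasis w], the difference [barM' b - b] is negated by bar and has only terms shorter
    than [w]. Writing it as [p - barM' p] makes [b + p] invariant. *)
Lemma selfdual_step : I w -> exists x, selfdual w x.
Proof.
move=> Iw; have [sb tb] := barM'_nbasis_supp Iw; set b := nbasis w.
have bmon y n : cv y n b = ((y == w) && (n == 0))%:R by exact: cf_basis.
have sdiff : supp (fun y n => nrange w y n /\ (l y < l w)%N) (barM' b - b).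
  move=> y n nz; have yw : y <> w.
    by move=> yw; move: nz; rewrite yw cfD cfN tb bmon eqxx subrr eqxx.
  have r : nrange w y n.
    apply: sb; move: nz; rewrite cfD cfN bmon.
    by case: (y =P w) => // _; rewrite /= subr0.
  by split; [exact: r|case: r => /bruhat_len[]].
have bdiff : barM' (barM' b - b) = - (barM' b - b).
  by rewrite (raddfB barM') barM'_invol opprB.
have [p sp ep] := antiselfdual_split (leqnn _) sdiff bdiff.
have pw n : cv w n p = 0.
  by apply/eqP/negPn/negP => /sp[_]; rewrite ltnn.
exists (b + p); split.
- have e : barM' b = p - barM' p + b by rewrite ep subrK.
  by rewrite (raddfD barM') e addrAC subrK addrC.
- apply: cf_suppD => [|y n /sp[] //].
  rewrite /b -[nbasis w]scale1r -(expr0z v); apply: (cf_supp_monom Iw).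
  exact: nrange_refl.
- by move=> y n; rewrite cfD bmon; case: (y =P w) => // _; rewrite /= add0r => /sp[].
- by move=> n; rewrite cfD pw addr0 bmon eqxx.
Qed.
End Existence.

Lemma selfdual_exists w : I w -> exists x, selfdual w x.
Proof.
elim: {w}(l w).+1 {-2}w (ltnSn (l w)) => [//|n IH] w lw Iw.
have /choice[A AP] : forall y, exists x, I y -> (l y < l w)%N -> selfdual y x.
  move=> y; have [[Iy ly]|h] := pselect (I y /\ (l y < l w)%N).
    have [x xP] := IH y (leq_trans ly lw) Iy; by exists x.
  by exists 0 => Iy ly; case: h.
exact: (selfdual_step AP).
Qed.

(** * Uniqueness *)

Lemma selfdual_neg_eq0 x : barM' x = x ->
  supp (fun _ (n : int) => n < 0) x ->
  (exists N, supp (fun y _ => l y < N)%N x) -> x = 0.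
Proof.
move=> bx neg [N]; elim: N => [|N IH] sx.
  apply: (cf_inj (t_tr := vQ_transcendental) (Hb := is_basis_nbasis)) => y n.
  by rewrite cf0; apply/eqP/negPn/negP => /sx.
apply: IH => y n nz; rewrite ltn_neqAle -ltnS (sx y n nz) andbT.
apply/negP => /eqP ly; have n0 := neg y n nz.
have [_ /(_ y n ly)] := barM'_top (N := N) (x := x) sx.
rewrite bx => e; move: nz; rewrite e => /neg; lia.
Qed.
(** The part of [is_A] that suffices for uniqueness and for the basis property; it does not record
    the parity of exponents. *)
Definition triangular w x :=
  (forall y (n : int), cv y n x != 0 -> y <=B w /\ (y <> w -> n < 0)) /\
  forall n : int, cv w n x = (n == 0)%:R.

Lemma selfdual_triangular w x : selfdual w x -> triangular w x.
Proof.
move=> [_ sx nx tx]; split=> // y n nz; split; last exact: nx.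
by have [] := sx y n nz.
Qed.

Lemma triangular_unique w x x' : barM' x = x -> barM' x' = x' ->
  triangular w x -> triangular w x' -> x = x'.
Proof.
move=> bx bx' [sx tx] [sx' tx']; apply/eqP; rewrite -subr_eq0; apply/eqP.
have h y (n : int) : cv y n (x - x') != 0 -> [/\ y <=B w, y <> w & n < 0].
  move=> nz; have yw : y <> w.
    by move=> yw; move: nz; rewrite yw cfD cfN tx tx' subrr eqxx.
  have [e|/sx[yw' n0]] := eqVneq (cv y n x) 0; last by split=> //; exact: n0.
  move: nz; rewrite cfD cfN e sub0r oppr_eq0 => /sx'[yw' n0].
  by split=> //; exact: n0.
apply: selfdual_neg_eq0; first by rewrite (raddfB barM') bx bx'.
  by move=> y n /h[].
by exists (l w) => y n /h[/bruhat_len[->//|]].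
Qed.

(** * Translation between coordinates and polynomials in u *)

Lemma zeval_rmorph (R R' : comNzRingType) (f : {rmorphism R -> R'}) c p :
  f (zeval c p) = zeval (f c) p.
Proof.
rewrite /zeval -horner_map -map_poly_comp; congr (_.[_]).
by apply: eq_map_poly => i /=; rewrite rmorph_int.
Qed.

Lemma lc_zeval_u (p : {poly int}) (n : int) :
  lc vQ_transcendental n (Au_Av (zeval u p)) = coefz (p \Po 'X^2) n.
Proof.
rewrite (@lcE _ _ _ _ (p \Po 'X^2) 0%N) ?addr0 // /laurent_repr expr0 mulr1.
have -> : val (Au_Av (zeval u p)) = zeval (vQ ^+ 2) p.
  rewrite (zeval_rmorph Au_Av) Au_Av_u (zeval_rmorph val).
  by congr (zeval _ p); exact: val_lgenX.
by rewrite /zeval map_comp_poly map_polyXn horner_comp hornerXn.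
Qed.

Lemma coefz_sqr (p : {poly int}) (n : int) : coefz (p \Po 'X^2) n != 0 ->
  exists2 i : nat, n = 2 * i%:Z & p`_i != 0.
Proof.
case: n => [k|//] /=; rewrite coef_comp_poly_Xn //; case: ifP => // /dvdnP[i ->].
by rewrite mulnK // => pi; exists i => //; rewrite mulnC PoszM.
Qed.

Lemma coefz_sqr_even (p : {poly int}) (i : nat) :
  coefz (p \Po 'X^2) (2 * i%:Z) = p`_i.
Proof. by rewrite -PoszM /= coef_comp_poly_Xn // dvdn_mulr // mulKn. Qed.

Lemma lower_finite w : finite_set [set y | I y /\ y <=B w].
Proof. by apply: sub_finite_set (bruhat_finite cox w) => y []. Qed.

(** Substituting [u = v ^ 2] turns [P y] into [P y \Po 'X^2], and passing to [nbasis y] shifts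
    exponents by [l y - l w]. *)
Lemma cf_is_A_sum w (P : W -> {poly int}) y (n : int) :
  cv y n (v ^ (- (l w)%:Z) *: \sum_(z \in [set z | I z /\ z <=B w])
    j (zeval u (P z) *: a z)) =
  if `[< I y /\ y <=B w >] then coefz (P y \Po 'X^2) (n + (l w)%:Z - (l y)%:Z)
  else 0.
Proof.
rewrite fsbig_finite; last exact: lower_finite.
rewrite scaler_sumr (eq_bigr (fun z =>
  (v ^ ((l z)%:Z - (l w)%:Z) * Au_Av (zeval u (P z))) *: nbasis z)); last first.
  move=> z _; rewrite jZ j_basis !scalerA; congr (_ * _ *: _).
  by rewrite mulrAC -vXD addrC.
have zE z : (z \in fset_set [set z | I z /\ z <=B w]) = `[< I z /\ z <=B w >].
  by rewrite (in_fset_set (lower_finite w)); apply/idP/asboolP; rewrite in_setE.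
rewrite /cf bcoord_uniq => [|z]; last by rewrite zE => /asboolP[].
rewrite zE.
case: ifP => _; last by rewrite raddf0.
by rewrite lc_mulXz lc_zeval_u opprB addrA.
Qed.

Lemma is_A_triangular w x : I w -> is_A S star a j barM' w x ->
  barM' x = x /\ triangular w x.
Proof.
move=> Iw [P [xE bx Pw Pdeg]]; split=> //; split=> [y n|n].
  rewrite xE cf_is_A_sum; case: asboolP => // -[Iy yw] /coefz_sqr[i ni pi].
  split=> // yNw; have := Pdeg y Iy (conj yw yNw).
  have : (i < size (P y))%N.
    by rewrite ltnNge; apply: contra pi => h; rewrite nth_default.
  by move: (size (P y)) => q; lia.
rewrite xE cf_is_A_sum; case: asboolP => [_|nw]; last first.
  by case: nw; split; [exact: Iw|exact: bruhat_refl].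
rewrite Pw addrK comp_polyC; case: n => [k|k] //=. by rewrite coefC; case: k.
Qed.

Lemma selfdual_is_A w x : I w -> selfdual w x -> is_A S star a j barM' w x.
Proof.
move=> Iw [bx sx nx tx].
(* By [nrange], every nonzero coefficient of [x] at [y] is reached by some [i <= l w - l y], so the
   truncation loses nothing. *)
pose P y : {poly int} := \poly_(i < (l w - l y).+1)
  cv y (2 * i%:Z + (l y)%:Z - (l w)%:Z) x.
exists P; split=> //.
- apply: (cf_inj (t_tr := vQ_transcendental) (Hb := is_basis_nbasis)) => y n.
  rewrite cf_is_A_sum; case: asboolP => [[Iy yw]|nyw]; last first.
    apply/eqP/negPn/negP => nz; apply: nyw; split; first exact: cf_dom nz.
    by have [] := sx y n nz.
  have [e|] := eqVneq (coefz (P y \Po 'X^2) (n + (l w)%:Z - (l y)%:Z)) 0.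
    rewrite e; apply/eqP/negPn/negP => nz; have [_ [i il ni]] := sx y n nz.
    move: e; have -> : n + (l w)%:Z - (l y)%:Z = 2 * i%:Z by lia.
    by rewrite coefz_sqr_even coef_poly ltnS il -ni => /eqP; rewrite (negbTE nz).
  move=> /[dup] /coefz_sqr[i ni _]; rewrite ni coefz_sqr_even coef_poly.
  case: ifP => // _ _; congr (cv _ _ _); lia.
- apply/polyP => i; rewrite coef_poly subnn ltnS leqn0 coef1.
  by case: i => [|i] //=; rewrite addrK mulr0 tx.
- move=> y Iy [yw yNw]; have ly : (l y < l w)%N by have [] := bruhat_len yw.
  (* For the zero polynomial [(size _).-1] is 0 and the bound is just [l y < l w]. *)
  have [P0|Pn0] := eqVneq (P y) 0; first by rewrite P0 size_poly0; lia.
  have : (P y)`_(size (P y)).-1 != 0 by rewrite -lead_coefE lead_coef_eq0.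
  rewrite {1}/P coef_poly; case: ifP => // _ /nx /(_ yNw).
  by move: (size (P y)).-1 => q; lia.
Qed.

(** * The basis property *)

Section Basis.
Variables (A : W -> M').
Hypothesis AP : forall y, I y -> triangular y (A y).

(** Inversion of a unitriangular matrix: [A y - nbasis y] involves only [nbasis z] with [z] shorter
    than [y]. *)
Lemma nbasis_in_span y : I y -> in_span I A (nbasis y).
Proof.
elim: {y}(l y).+1 {-2}y (ltnSn (l y)) => [//|n IH] y ly Iy.
have [sA tA] := AP Iy.
have : in_span I A (A y - nbasis y).
  apply: (@cf_ind _ _ vQ_transcendental _ _ _ _ is_basis_nbasis (in_span I A)).
  - exact: in_span0.
  - by move=> x x' sx sx'; rewrite addrC -scaleN1r; exact: in_spanZD.
  move=> z k Iz nz; rewrite -[_ *: _]addr0; apply: in_spanZD; last exact: in_span0.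
  apply: IH => //; have zy : z <> y.
    move=> zy; move: nz; rewrite zy cfD cfN tA.
    by rewrite (cf_basis vQ_transcendental is_basis_nbasis _ _ Iy) eqxx subrr eqxx.
  move: nz; rewrite cfD cfN (cf_basis vQ_transcendental is_basis_nbasis _ _ Iy).
  case: (z =P y) => //= _; rewrite subr0 => /sA[/bruhat_len[//|lz] _].
  exact: leq_trans lz _.
move=> /(in_spanZD (-1)) /(_ (in_span_basis A Iy)).
by rewrite scaleN1r opprB subrK.
Qed.

Lemma triangular_basis : is_basis I A.
Proof.
apply: is_basisI => [x|c s Is eq0].
  apply: (@cf_ind _ _ vQ_transcendental _ _ _ _ is_basis_nbasis (in_span I A)).
  - exact: in_span0.
  - by move=> y y' sy sy'; rewrite addrC -scaleN1r; exact: in_spanZD.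
  move=> z k Iz _; rewrite -[_ *: _]addr0; apply: in_spanZD; last exact: in_span0.
  exact: nbasis_in_span.
have coA y z : I z -> bcoord is_basis_nbasis y (A z) != 0 -> y <=B z.
  move=> Iz nz; apply: contrapT => nyz; move/eqP: nz; apply.
  apply: (lc_inj (t_tr := vQ_transcendental)) => n; rewrite raddf0.
  by apply/eqP/negPn/negP => nz; have [/(_ y n nz)[]] := AP Iz.
have coAA y : I y -> bcoord is_basis_nbasis y (A y) = 1.
  move=> Iy; apply: (lc_inj (t_tr := vQ_transcendental)) => n.
  by rewrite lc1; have [_] := AP Iy; apply.
pose N := \max_(i <- s) l i.
have lN i : i \in s -> (l i <= N)%N by move=> si; exact: leq_bigmax_seq.
(* Descending induction on length from the maximum [N]: the coordinate at [i] of the relation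
   involves [c i] and only those [c z] with [z] longer than [i], which vanish already. *)
suff h k i : i \in s -> (N < l i + k)%N -> c i = 0.
  by move=> i si; apply: (h N.+1 i si); rewrite addnS ltnS leq_addl.
elim: k i => [|k IH] i si lik.
  by move: lik; rewrite addn0 ltnNge lN.
have := congr1 (bcoord is_basis_nbasis i) eq0; rewrite raddf0 raddf_sum /=.
rewrite (big_fsetD1 i) //= big_seq big1 => [|z].
  by rewrite addr0 bcoordZ coAA ?mulr1 //; exact: Is.
rewrite !inE => /andP[zi sz]; rewrite bcoordZ.
have [->|/(coA _ _ (Is z sz))] := eqVneq (bcoord is_basis_nbasis i (A z)) 0.
  by rewrite mulr0.
move=> /bruhat_len[iz|lz]; first by rewrite iz eqxx in zi.
by rewrite (IH z sz) ?mul0r //; lia.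
Qed.
End Basis.
End FinalBasis.

Theorem theorem0p4
  (W : groupType) (S : set W) (cox : coxeter_system S)
  (star : W -> W) (Hstar : star_automorphism S star)
  (H : unitAlgType Au) (T : W -> H) (HH : hecke_algebra S T)
  (barH : {rmorphism H -> H}) (HbarH : hecke_bar T barH)
  (M : lmodType Au) (a : W -> M) (act : H -> M -> M)
  (HM : involution_module S star T a act)
  (barM : {additive M -> M}) (HbarM : involution_bar barH a act barM)
  (M' : lmodType Av) (j : M -> M') (HM' : is_base_change Au_Av j)
  (barM' : {additive M' -> M'}) (HbarM' : extends_bar barM j barM') :
  (forall w : W, twisted_involution star w ->
     exists! x : M', is_A S star a j barM' w x) /\
  (forall A : W -> M',
     (forall w : W, twisted_involution star w ->
        is_A S star a j barM' w (A w)) ->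
     is_basis (twisted_involution star) A).
Proof.
split=> [w Iw|A AP].
  have [x sx] := selfdual_exists cox Hstar HH HbarH HM HbarM HM' HbarM' Iw.
  exists x; split=> [|x' Ax'].
    exact: selfdual_is_A sx.
  have [bx' tx'] := is_A_triangular cox HM HM' Iw Ax'.
  have [bx _ _ _] := sx.
  exact: (triangular_unique cox Hstar HH HbarH HbarM HbarM' bx bx'
            (selfdual_triangular sx) tx').
apply: (triangular_basis (HM := HM) (HM' := HM')) => y Iy.
by have [] := is_A_triangular cox HM HM' Iy (AP y Iy).
Qed.
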